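(* Let $H$ be a numerical semigroup with embedding dimension $n\ge3$ and multiplicity $a_0$. Assume that there exist integers $h>0$ and $\alpha\ne0$ such that $\mathrm{PF}(H)=\{h+\alpha,h+2\alpha,\ldots,h+(n-1)\alpha\}$ and $\gcd(a_0,\alpha)=1$. Let $G=\{a_0,a_1,\ldots,a_i,a_1',\ldots,a_j',a_1'',\ldots,a_k''\}$ be the minimal system of generators of $H$, labelled as described in the context, let $\mathbb{K}$ be a field, let $S=\mathbb{K}[X_0,X_1,\ldots,X_i,X_1',\ldots,X_j',X_1'',\ldots,X_k'']$, and let $I_H$ be the kernel of the $\mathbb{K}$-algebra homomorphism $\varphi:S\to\mathbb{K}[t]$ with $\varphi(X_s)=t^{a_s}$, $\varphi(X_s')=t^{a_s'}$, $\varphi(X_s'')=t^{a_s''}$. If $$v_\alpha(a_i)+v_{-\alpha}(a_1'')<n-1,$$ then (one has $j\ge 1$, so that the matrices below make sense, and) there exist positive integers $c_0,c_1,\ldots,c_i,c_0'',c_1'',\ldots,c_k''$ such that $$I_H=\mathrm{I}_2(M_+\ M_0\ M_-),$$ where $$M_+=\begin{pmatrix}X_0^{c_0}&X_1^{c_1}&\cdots&X_{i-1}^{c_{i-1}}&X_i^{c_i}\\ X_1&X_2&\cdots&X_i&X_1'\end{pmatrix},\qquad M_0=\begin{pmatrix}X_1'&X_2'&\cdots&X_{j-1}'\\ X_2'&X_3'&\cdots&X_j'\end{pmatrix},$$ $$M_-=\begin{pmatrix}X_j'&X_1''&X_2''&\cdots&X_{k-1}''&X_k''\\ (X_1'')^{c_1''}&(X_2'')^{c_2''}&(X_3'')^{c_3''}&\cdots&(X_k'')^{c_k''}&X_0^{c_0''}\end{pmatrix}.$$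 Conventions: if $i=0$, then $v_\alpha(a_i)$ is read as $0$ and $M_+=\begin{pmatrix}X_0^{c_0}\\ X_1'\end{pmatrix}$; if $k=0$, then $v_{-\alpha}(a_1'')$ is read as $0$ and $M_-=\begin{pmatrix}X_j'\\ X_0^{c_0''}\end{pmatrix}$; if $j=1$, then $M_0$ has no columns.
   Context: A numerical semigroup is a submonoid $H$ of $(\mathbb{Z}_{\ge0},+)$ with finite complement; its multiplicity is $a_0=\min(H\setminus\{0\})$ and its embedding dimension $n$ is the number of elements of its unique minimal generating set. $\mathrm{PF}(H)$ is the set of $p\in\mathbb{Z}_{\ge0}\setminus H$ with $p+x\in H$ for all $x\in H$, $x>0$, and $\mathrm{PF}_+(H)=\{p+a_0:p\in\mathrm{PF}(H)\}$. For an integer $\gamma$ coprime to $a_0$ and $m\in\mathbb{Z}$, $v_\gamma(m)$ denotes the unique integer in $\{0,1,\ldots,a_0-1\}$ with $m\equiv v_\gamma(m)\,\gamma \pmod{a_0}$. Labelling of the generators: $\{a_1',\ldots,a_j'\}=G\cap\mathrm{PF}_+(H)$; $a_1,\ldots,a_i$ are the elements $a$ of $G\setminus(\{a_0\}\cup\mathrm{PF}_+(H))$ with $v_\alpha(a)<\min v_\alpha(\mathrm{PF}_+(H))$; $a_1'',\ldots,a_k''$ are the elements $a$ of $G\setminus(\{a_0\}\cup\mathrm{PF}_+(H))$ with $v_\alpha(a)>\max v_\alpha(\mathrm{PF}_+(H))$ (these exhaust $G$); and they are ordered so that $v_\alpha(a_0)=0<v_\alpha(a_1)<\cdots<v_\alpha(a_i)<v_\alpha(a_1')<\cdots<v_\alpha(a_j')<v_\alpha(a_1'')<\cdots<v_\alpha(a_k'')$.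 Thus $n=1+i+j+k$, and $i,j,k\ge 0$. For a matrix $M$ over $S$, $\mathrm{I}_2(M)$ is the ideal generated by its $2\times2$ minors, and $(M_+\ M_0\ M_-)$ denotes horizontal concatenation. *)

(* Defs.v *)
From HB Require Import structures.
From mathcomp Require Import all_boot all_order all_algebra.
From mathcomp Require Import mpoly.

Set Implicit Arguments.
Unset Strict Implicit.
Unset Printing Implicit Defensive.

Import Order.TTheory GRing.Theory Num.Theory.

Local Open Scope ring_scope.

Definition numerical_semigroup (H : {pred nat}) : Prop :=
  [/\ 0%N \in H,
      {in H &, forall x y, (x + y)%N \in H}
    & exists gaps : seq nat, forall x, x \notin H -> x \in gaps].

Definition multiplicity_of (H : {pred nat}) (m : nat) : Prop :=
  [/\ m \in H, (0 < m)%N & forall x, x \in H -> (0 < x)%N -> (m <= x)%N].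

Definition generates (G : seq nat) (H : {pred nat}) : Prop :=
  forall x : nat,
    x \in H <-> exists c : nat -> nat, x = (\sum_(g <- G) c g * g)%N.

Definition minimal_generators (G : seq nat) (H : {pred nat}) : Prop :=
  [/\ uniq G, generates G H
    & forall G' : seq nat,
        {subset G' <= G} -> generates G' H -> {subset G <= G'}].

(* A set of integers, so that it can be compared with an arithmetic
   progression whose difference may be negative. *)
Definition PF (H : {pred nat}) (p : int) : Prop :=
  exists2 q : nat, p = q%:Z &
    q \notin H /\ (forall x, x \in H -> (0 < x)%N -> (q + x)%N \in H).

Definition PFplus (H : {pred nat}) (a0 : nat) (q : int) : Prop :=
  exists2 p : int, PF H p & q = p + a0%:Z.

(* The residue v_gamma(m) modulo a0; see [vresP] and [vres_uniq]. *)
Definition vres (a0 : nat) (gamma m : int) : nat :=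
  find (fun v : nat => (m == v%:Z * gamma %[mod a0%:Z])%Z) (iota 0 a0).

Lemma vresP (a0 : nat) (gamma m : int) :
  (0 < a0)%N -> coprimez a0%:Z gamma ->
  (vres a0 gamma m < a0)%N /\ (m = (vres a0 gamma m)%:Z * gamma %[mod a0%:Z])%Z.
Proof.
move=> a0_gt0 cop; set P := fun v : nat => (m == v%:Z * gamma %[mod a0%:Z])%Z.
have a0n0 : a0%:Z != 0 by rewrite -lt0n in a0_gt0 *; case: (a0) a0_gt0.
have hasP : has P (iota 0 a0).
  have [[u v] /= Duv] := coprimezP _ _ cop.
  have w_ge0 := modz_ge0 (m * v) a0n0.
  have w_lt := ltz_pmod (m * v) (a0_gt0 : 0 < a0%:Z).
  apply/hasP; exists `|(m * v %% a0%:Z)%Z|%N.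
    by rewrite mem_iota add0n /= -ltz_nat gez0_abs.
  rewrite /P gez0_abs // modzMml.
  by rewrite eqz_mod_dvd -mulrA -{1}[m]mulr1 -Duv -mulrBr addrK !dvdz_mull.
have lt_v : (find P (iota 0 a0) < a0)%N by rewrite -[X in (_ < X)%N](size_iota 0) -has_find.
by split=> //; have /eqP := nth_find 0%N hasP; rewrite nth_iota.
Qed.

Lemma vres_uniq (a0 : nat) (gamma m : int) (v : nat) :
  coprimez a0%:Z gamma -> (v < a0)%N -> (m = v%:Z * gamma %[mod a0%:Z])%Z ->
  vres a0 gamma m = v.
Proof.
move=> cop v_lt Dm; have a0_gt0 : (0 < a0)%N by case: (a0) v_lt.
have [w_lt] := vresP m a0_gt0 cop; set w := vres _ _ _ in w_lt *.
rewrite Dm => /eqP; rewrite eqz_mod_dvd -mulrBl Gauss_dvdzl // -eqz_mod_dvd.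
by rewrite !modz_nat !modn_small // => /eqP[].
Qed.

(* Only the values [a s] for 0 <= s <= i, [a' s] for 1 <= s <= j and [a'' s]
   for 1 <= s <= k matter. *)
Definition gen_list (i j k : nat) (a a' a'' : nat -> nat) : seq nat :=
  [seq a s | s <- iota 0 i.+1] ++ [seq a' s | s <- iota 1 j]
    ++ [seq a'' s | s <- iota 1 k].

Definition labelling (H : {pred nat}) (alpha : int) (a0 : nat) (G : seq nat)
    (i j k : nat) (a a' a'' : nat -> nat) : Prop :=
  let v := vres a0 alpha in
  (* PF(H) is finite and, when the labelling is used, nonempty: being below
     (above) the min (max) of v on PF_+(H) is quantified over its elements. *)
  let other x := [/\ x \in G, x <> a0 & ~ PFplus H a0 x%:Z] in
  [/\ a 0%N = a0,
      forall x, x \in [seq a s | s <- iota 1 i] <->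
        other x /\ (forall q, PFplus H a0 q -> (v x < v q)%N),
      forall x, x \in [seq a' s | s <- iota 1 j] <->
        x \in G /\ PFplus H a0 x%:Z,
      forall x, x \in [seq a'' s | s <- iota 1 k] <->
        other x /\ (forall q, PFplus H a0 q -> (v q < v x)%N)
    & G =i gen_list i j k a a' a'' /\
      sorted ltn [seq v x%:Z | x <- gen_list i j k a a' a'']].

Definition ideal_generated (R : comNzRingType) (A : R -> Prop) (x : R) : Prop :=
  exists2 s : seq (R * R), (forall u, u \in s -> A u.2)
    & x = \sum_(u <- s) u.1 * u.2.

Definition minor2 (R : comNzRingType) (m n : nat) (M : 'M[R]_(m, n)) (x : R) :
    Prop :=
  exists (f : 'I_2 -> 'I_m) (g : 'I_2 -> 'I_n),
    [/\ {homo f : u w / (u < w)%N}, {homo g : u w / (u < w)%N}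
      & x = \det (mxsub f g M)].

Definition I2 (R : comNzRingType) (m n : nat) (M : 'M[R]_(m, n)) : R -> Prop :=
  ideal_generated (minor2 M).

(* The variables of S, in the order X_0..X_i, X'_1..X'_j, X''_1..X''_k. *)
Notation polyS K i j k := {mpoly K[(i + j + k).+1]}.

Definition varX (K : fieldType) (i j k s : nat) : polyS K i j k := 'X_(inord s).
Definition varX' (K : fieldType) (i j k s : nat) : polyS K i j k :=
  'X_(inord (i + s)).
Definition varX'' (K : fieldType) (i j k s : nat) : polyS K i j k :=
  'X_(inord (i + j + s)).

Definition phi (K : fieldType) (i j k : nat) (a a' a'' : nat -> nat)
    (p : polyS K i j k) : {poly K} :=
  mmap (@polyC K)
    (fun r : 'I_(i + j + k).+1 => 'X^(nth 0%N (gen_list i j k a a' a'') r)) p.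

Definition I_H (K : fieldType) (i j k : nat) (a a' a'' : nat -> nat)
    (p : polyS K i j k) : Prop :=
  phi a a' a'' p = 0.

Definition Mplus (K : fieldType) (i j k : nat) (c : nat -> nat) :
    'M[polyS K i j k]_(2, i.+1) :=
  \matrix_(r < 2, s < i.+1)
    if r == ord0 then varX K i j k s ^+ c s
    else if (s < i)%N then varX K i j k s.+1 else varX' K i j k 1.

Definition Mzero (K : fieldType) (i j k : nat) :
    'M[polyS K i j k]_(2, j.-1) :=
  \matrix_(r < 2, s < j.-1)
    if r == ord0 then varX' K i j k s.+1 else varX' K i j k s.+2.

Definition Mminus (K : fieldType) (i j k : nat) (c'' : nat -> nat) :
    'M[polyS K i j k]_(2, k.+1) :=
  \matrix_(r < 2, s < k.+1)
    if r == ord0 then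
      if (s == 0 :> nat)%N then varX' K i j k j else varX'' K i j k s
    else if (s < k)%N then varX'' K i j k s.+1 ^+ c'' s.+1
    else varX K i j k 0 ^+ c'' 0%N.

(* Main.v *)
Require Import Defs.
From mathcomp Require Import all_boot all_order all_algebra.
From mathcomp Require Import mpoly zify ring.

Set Implicit Arguments.
Unset Strict Implicit.
Unset Printing Implicit Defensive.

Import Order.TTheory GRing.Theory Num.Theory.
Local Open Scope ring_scope.

(** Let [C r] be the least integer [c] with [r alpha + c a0] in [H]; then [C] is
subadditive, [C (r + a0) = C r - alpha], and the Apery set consists of the
[r alpha + C r a0].  The hypothesis on [PF H] says that the maximal residues are
[m+1, ..., m+n-1] and that [C] is constant on them.  The bound on
[v_alpha(a_i) + v_(-alpha)(a''_1)] forbids an Apery element to be divisible both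
by a generator with residue below and by one with residue above the maximal
ones.  Hence [C] is nondecreasing on [1, m] and [C r + C (m+1-r)] is constant
there; counting the maximal elements that are not generators on both sides then
forces [a_(s+1) = c_s a_s + alpha], and symmetrically on the other side, so that
all columns of the matrix have the same degree [alpha].

For the lexicographic order the minors have initial monomials (top of column
[b]) * (bottom of column [a]), [a < b].  A monomial avoiding them is, up to a power
of [X_0], a greedy expansion in [a_1, ..., a_i], a single [X'_s], or a greedy
expansion in the [a''_s]; these have distinct residues modulo [a0], so monomials
of the same degree are congruent modulo the minors. *)

(** * The function [C] *)

Lemma ndvdz_small (a r : int) : r != 0 -> - a < r < a -> ~~ (a %| r)%Z.
Proof. by move=> r0 ra; apply/negP => /dvdzP[q Dr]; have [q0|q0|q0] := ltgtP q 0; nia. Qed.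

Lemma dvdzNr (a r : int) : (a %| - r)%Z = (a %| r)%Z.
Proof. exact: rpredN. Qed.

(** The modulus is [a0 = m + Q + N + 1]: the nonzero residues are [m] low ones, the [N] maximal ones
    [m + l], and [Q] high ones, represented by [-Q, ..., -1]. Low and high generators have residues
    [v s] and [- u t]; [mid l] marks the maximal residues of generators. Collecting these facts
    about [C] makes the reflection of residues available as a symmetry. *)
Record apery_profile (C : int -> int) (alpha : int) (m Q N : nat) (e : int)
    (i k : nat) (v u : nat -> nat) (mid : nat -> Prop) : Prop := ApProfile {
  ap_0 : C 0 = 0;
  ap_sub : forall x y : int, C (x + y) <= C x + C y;
  ap_per : forall x : int, C (x + (m + Q + N + 1)%:Z) = C x - alpha;
  ap_top : forall l : nat, (1 <= l <= N)%N -> C (m%:Z + l%:Z) = e;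
  ap_max : forall (l : nat) (r : int), (1 <= l <= N)%N ->
    ~~ ((m + Q + N + 1)%:Z %| r)%Z -> C (m%:Z + l%:Z + r) < e + C r;
  ap_below : forall r : int, ~~ ((m + Q + N + 1)%:Z %| r)%Z ->
    exists2 l : nat, (1 <= l <= N)%N & C r + C (m%:Z + l%:Z - r) = e;
  ap_pos : forall r : int, ~~ ((m + Q + N + 1)%:Z %| r)%Z ->
    0 < r * alpha + C r * (m + Q + N + 1)%:Z;
  ap_gen : forall r : int, ~~ ((m + Q + N + 1)%:Z %| r)%Z ->
    exists2 y : int, C r = C y + C (r - y) &
    [\/ exists2 s : nat, (1 <= s <= i)%N & y = (v s)%:Z,
        exists2 t : nat, (1 <= t <= k)%N & y = - (u t)%:Z
      | exists2 l : nat, (1 <= l <= N)%N /\ mid l & y = m%:Z + l%:Z];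
  ap_vinc : forall s t, (1 <= s)%N -> (s < t)%N -> (t <= i)%N -> (v s < v t)%N;
  ap_uinc : forall s t, (1 <= s)%N -> (s < t)%N -> (t <= k)%N -> (u s < u t)%N;
  ap_v : forall s, (1 <= s <= i)%N -> (1 <= v s)%N /\ (v s <= m)%N;
  ap_u : forall s, (1 <= s <= k)%N -> (1 <= u s)%N /\ (u s <= Q)%N;
  ap_vN : forall s, (1 <= s <= i)%N -> (v s < N)%N;
  ap_uN : forall s, (1 <= s <= k)%N -> (u s < N)%N;
  ap_uv : forall s t, (1 <= s <= i)%N -> (1 <= t <= k)%N -> (v s + u t < N)%N;
  ap_N : (2 <= N)%N
}.

(* [r |-> - r] exchanges the generators below and above the maximal ones. *)
Lemma ap_flip C alpha m Q N e i k v u mid :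
  apery_profile C alpha m Q N e i k v u mid ->
  apery_profile (fun r => C (- r)) (- alpha) Q m N (e + alpha) k i u v
    (fun l => mid (N.+1 - l)%N).
Proof.
case=> H0 Hs Hp Ht Hm Hb Hpos Hg Hv Hu Hv1 Hu1 HvN HuN Huv HN.
have Ea : (Q + m + N + 1 = m + Q + N + 1)%N by lia.
have per' (x : int) : C (x - (m + Q + N + 1)%:Z) = C x + alpha.
  by rewrite -[in RHS](subrK (m + Q + N + 1)%:Z x) Hp subrK.
(* Adding [a0] to [- (Q + l + r)] gives [m + (N + 1 - l) - r]; this period costs [alpha], hence the
   new constant [e + alpha]. *)
have refl (l : nat) (r : int) : (1 <= l <= N)%N ->
    C (- (Q%:Z + l%:Z + r)) = C (m%:Z + (N.+1 - l)%N%:Z - r) + alpha.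
  by move=> ll; rewrite -per'; congr C; lia.
split => //; rewrite ?Ea; cbv beta; do ?[by rewrite oppr0].
- by move=> x y; rewrite opprD.
- by move=> x; rewrite opprD per' opprK.
- move=> l ll; rewrite -[Q%:Z + l%:Z]addr0 refl // subr0 Ht //; lia.
- move=> l r ll nr; rewrite refl //.
  have := Hm (N.+1 - l)%N (- r); rewrite dvdzNr => /(_ _ nr).
  have ll' : (0 < N.+1 - l <= N)%N by lia.
  by move=> /(_ ll'); lia.
- move=> r nr; have := Hb (- r); rewrite dvdzNr => /(_ nr) [l ll El].
  exists (N.+1 - l)%N; first lia.
  rewrite refl; last lia.
  have -> : (N.+1 - (N.+1 - l))%N = l by lia.
  rewrite opprK in El *; lia.
- by move=> r nr; have := Hpos (- r); rewrite dvdzNr => /(_ nr); rewrite mulNr mulrN.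
- move=> r nr; have := Hg (- r); rewrite dvdzNr => /(_ nr) [y Ey Hy].
  case: Hy => [[s s1 ys]|[t t1 yt]|[l [l1 ml] yl]].
  + exists (- y); first by rewrite Ey opprK; congr (_ + C _); lia.
    by constructor 2; exists s => //; rewrite ys.
  + exists (- y); first by rewrite Ey opprK; congr (_ + C _); lia.
    by constructor 1; exists t => //; rewrite yt opprK.
  + exists (Q%:Z + (N.+1 - l)%N%:Z).
      rewrite Ey; have -> : - (Q%:Z + (N.+1 - l)%N%:Z) = y - (m + Q + N + 1)%:Z by lia.
      have -> : - (r + (y - (m + Q + N + 1)%:Z)) = - r - y + (m + Q + N + 1)%:Z by lia.
      by rewrite Hp per'; ring.
    constructor 3; exists (N.+1 - l)%N => //; split; first lia.
    by have -> : (N.+1 - (N.+1 - l))%N = l by lia.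
- by move=> s t s1 t1; rewrite addnC; apply: Huv.
Qed.

(** * Divisibility between Apery elements *)

Section Profile.
Variables (C : int -> int) (alpha : int) (m Q N : nat) (e : int).
Variables (i k : nat) (v u : nat -> nat) (mid : nat -> Prop).
Hypothesis P : apery_profile C alpha m Q N e i k v u mid.

Local Notation a0 := (m + Q + N + 1)%:Z.

(** Both [m + 1] and [m + 1 + r] are maximal, so [C] equals [e] at both, and [ap_max] is strict. *)
Lemma ap_gt0 r : (1 <= r)%N -> (r < N)%N -> 1 <= C r%:Z.
Proof.
move=> r1 rN; have l1 : (1 <= 1 <= N)%N by lia.
have nr : ~~ (a0 %| r%:Z)%Z by apply: ndvdz_small; lia.
have := ap_max P l1 nr.
have -> : m%:Z + 1%:Z + r%:Z = m%:Z + (r.+1)%:Z by lia.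
rewrite (ap_top P); lia.
Qed.

(** An equation [C z = C y + C (z - y)] says that the Apery element of [z] is the sum of those of
    [y] and [z - y], that is, [y] divides [z]. Subadditivity makes this relation transitive. *)
Lemma ap_trans (y r z : int) :
  C r = C y + C (r - y) -> C z = C r + C (z - r) ->
  C z = C y + C (z - y) /\ C (z - y) = C (r - y) + C (z - r).
Proof.
move=> yr rz; have := ap_sub P (r - y) (z - r); have := ap_sub P y (z - y).
have -> : r - y + (z - r) = z - y by ring.
have -> : y + (z - y) = z by ring.
lia.
Qed.

(** A maximal cofactor would force [C y = 0], against the strict inequality of [ap_max]. *)
Lemma ap_div_top (y : int) (l : nat) :
  (1 <= l <= N)%N -> ~~ (a0 %| y)%Z ->
  e = C y + C (m%:Z + l%:Z - y) ->
  forall l' : nat, (1 <= l' <= N)%N -> m%:Z + l%:Z - y != m%:Z + l'%:Z.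
Proof.
move=> ll ny E l' ll'; apply/eqP => E'.
move: E; rewrite E' (ap_top P ll') => E.
have := ap_max P ll' ny; rewrite -E' subrK (ap_top P ll); lia.
Qed.

Lemma ap_div_top_v s (l : nat) : (1 <= s <= i)%N -> (1 <= l <= N)%N ->
  e = C (v s)%:Z + C (m%:Z + l%:Z - (v s)%:Z) -> (l <= v s)%N.
Proof.
move=> si ll E; rewrite leqNgt; apply/negP => lt.
have [v1 vm] := ap_v P si.
have nv : ~~ (a0 %| (v s)%:Z)%Z by apply: ndvdz_small; lia.
have ll' : (1 <= l - v s <= N)%N by lia.
by have := ap_div_top ll nv E ll'; lia.
Qed.

Lemma ap_div_top_u t (l : nat) : (1 <= t <= k)%N -> (1 <= l <= N)%N ->
  e = C (- (u t)%:Z) + C (m%:Z + l%:Z + (u t)%:Z) -> (N < l + u t)%N.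
Proof.
move=> ti ll E; rewrite ltnNge; apply/negP => lt.
have [u1 um] := ap_u P ti.
have nu : ~~ (a0 %| - (u t)%:Z)%Z by apply: ndvdz_small; lia.
have ll' : (1 <= l + u t <= N)%N by lia.
by have := @ap_div_top _ _ ll nu; rewrite opprK => /(_ E _ ll'); lia.
Qed.

(** Some maximal [m + l] is divisible by [r], hence by both generators; then [l <= v s] and
    [N < l + u t], against [v s + u t < N]. *)
Lemma ap_nomix (r : int) s t : (1 <= s <= i)%N -> (1 <= t <= k)%N -> ~~ (a0 %| r)%Z ->
  C r = C (v s)%:Z + C (r - (v s)%:Z) -> C r = C (- (u t)%:Z) + C (r + (u t)%:Z) ->
  False.
Proof.
move=> si tk nr Ev Eu; have [l ll El] := ap_below P nr.
have Et := ap_top P ll.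
have [] := @ap_trans _ _ (m%:Z + l%:Z) Ev; first by lia.
rewrite Et => /(ap_div_top_v si ll) lv _.
have [] := @ap_trans (- (u t)%:Z) r (m%:Z + l%:Z); rewrite ?opprK //; first by lia.
rewrite Et => /(ap_div_top_u tk ll) lu _.
have := ap_uv P si tk; lia.
Qed.

Lemma ap_max_proper (l : nat) (z : int) : (1 <= l <= N)%N ->
  ~~ (a0 %| z - (m%:Z + l%:Z))%Z -> C z < C (m%:Z + l%:Z) + C (z - (m%:Z + l%:Z)).
Proof.
move=> ll /(ap_max P ll); rewrite (ap_top P ll).
by have -> : m%:Z + l%:Z + (z - (m%:Z + l%:Z)) = z by ring.
Qed.

(** This is the Apery element of [r], the measure for the joint induction on both sides. *)
Definition ap_size (r : int) : nat := `|(r * alpha + C r * a0)%R|%N.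

Lemma ap_size_lt (y z : int) : ~~ (a0 %| y)%Z -> ~~ (a0 %| z)%Z -> ~~ (a0 %| z - y)%Z ->
  C z = C y + C (z - y) -> (ap_size (z - y) < ap_size z)%N.
Proof.
move=> /(ap_pos P) yp /(ap_pos P) zp /(ap_pos P) zyp E; rewrite /ap_size; nia.
Qed.

(** Take a generator dividing [z]. Unless it is low and at most [z], either it or its cofactor is
    maximal, or induction on the cofactor supplies a divisor of [z] from the opposite side, contrary
    to [ap_nomix]. *)
Lemma ap_dec_step (z : int) :
  0 < z <= m%:Z ->
  (forall z' : int, (ap_size z' < ap_size z)%N -> 0 < z' <= m%:Z ->
     exists2 s, (1 <= s <= i)%N & C z' = C (v s)%:Z + C (z' - (v s)%:Z)) ->
  (forall z' : int, (ap_size z' < ap_size z)%N -> - Q%:Z <= z' < 0 ->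
     exists2 t, (1 <= t <= k)%N & C z' = C (- (u t)%:Z) + C (z' + (u t)%:Z)) ->
  exists2 s, (1 <= s <= i)%N & 
    (v s)%:Z <= z /\ C z = C (v s)%:Z + C (z - (v s)%:Z).
Proof.
move=> zm IHp IHn; have nz : ~~ (a0 %| z)%Z by apply: ndvdz_small; lia.
have [y Ey [[s si ys]|[t tk yt]|[l [ll _] yl]]] := ap_gen P nz.
- have [v1 vm] := ap_v P si; have vN := ap_vN P si.
  rewrite {}ys in Ey.
  have [vz|zv] := leP (v s)%:Z z; first by exists s.
  have [zQ|Qz] := leP (- Q%:Z) (z - (v s)%:Z).
    have [||t tk Et] := IHn (z - (v s)%:Z) _ _.
    - by apply: ap_size_lt => //; apply: ndvdz_small; lia.
    - lia.
    have [] := @ap_trans (- (u t)%:Z) (z - (v s)%:Z) z; rewrite ?opprK //.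
      have -> : z - (z - (v s)%:Z) = (v s)%:Z by ring.
      lia.
    by move=> Eu _; case: (ap_nomix si tk nz Ey Eu).
  (* Here [z - v s < - Q]; since [v s < N], adding [a0] lands in the maximal block, and a maximal
     residue would properly divide [z]. *)
  have ll : (1 <= `|(z - (v s)%:Z + Q%:Z + N%:Z + 1)%R|%N <= N)%N by lia.
  have := @ap_max_proper _ (z + a0) ll.
  set x := m%:Z + _.
  have -> : x = z - (v s)%:Z + a0 by rewrite /x; lia.
  have -> : z + a0 - (z - (v s)%:Z + a0) = (v s)%:Z by ring.
  rewrite !(ap_per P) => H; suff: false by []. 
  have : ~~ (a0 %| (v s)%:Z)%Z by apply: ndvdz_small; lia.
  move=> /H; lia.
- have [u1 um] := ap_u P tk; have uN := ap_uN P tk.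
  rewrite {}yt opprK in Ey.
  have [zQ|Qz] := leP (z + (u t)%:Z) m%:Z.
    have [||s si Es] := IHp (z + (u t)%:Z) _ _.
    - by rewrite -[_%:Z in X in (X < _)%N]opprK; apply: ap_size_lt; rewrite ?opprK //;
         apply: ndvdz_small; lia.
    - lia.
    have [] := @ap_trans (v s)%:Z (z + (u t)%:Z) z; rewrite ?opprK //.
      have -> : z - (z + (u t)%:Z) = - (u t)%:Z by ring.
      lia.
    by move=> Eu _; case: (ap_nomix si tk nz Eu Ey).
  have ll : (1 <= `|(z + (u t)%:Z - m%:Z)%R|%N <= N)%N by lia.
  have := @ap_max_proper _ z ll.
  set x := m%:Z + _.
  have -> : x = z + (u t)%:Z by rewrite /x; lia.
  have -> : z - (z + (u t)%:Z) = - (u t)%:Z by ring.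
  move=> H; suff: false by []. 
  have : ~~ (a0 %| - (u t)%:Z)%Z by apply: ndvdz_small; lia.
  move=> /H; lia.
- suff: false by [].
  have : ~~ (a0 %| z - (m%:Z + l%:Z))%Z by apply: ndvdz_small; lia.
  by move=> /(ap_max_proper ll); rewrite -yl; lia.
Qed.

End Profile.

(** Both sides are treated together because a cofactor may change sign; the second half is the step
    lemma for the reflected profile. *)
Lemma ap_dec_joint C alpha m Q N e i k v u mid
    (P : apery_profile C alpha m Q N e i k v u mid) (b : nat) (z : int) :
  (ap_size C alpha m Q N z < b)%N ->
  (0 < z <= m%:Z -> exists2 s, (1 <= s <= i)%N &
     (v s)%:Z <= z /\ C z = C (v s)%:Z + C (z - (v s)%:Z)) /\
  (- Q%:Z <= z < 0 -> exists2 t, (1 <= t <= k)%N &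
     (u t)%:Z <= - z /\ C z = C (- (u t)%:Z) + C (z + (u t)%:Z)).
Proof.
elim: b z => // b IH z zb; split=> zm.
  apply: (ap_dec_step P zm) => z' z'z z'm.
    by have [/(_ z'm)[s si [_ Es]] _] := IH z' (leq_trans z'z zb); exists s.
  by have [_ /(_ z'm)[t tk [_ Et]]] := IH z' (leq_trans z'z zb); exists t.
have sizeN (x : int) : ap_size (fun r => C (- r)) (- alpha) Q m N x =
    ap_size C alpha m Q N (- x).
  by rewrite /ap_size mulrN mulNr (addnC Q).
have z0 : 0 < - z <= Q%:Z by lia.
have [||t tk [ut Et]] := ap_dec_step (ap_flip P) z0.
- rewrite sizeN opprK => z' z'z z'm.
  have z'm' : - Q%:Z <= - z' < 0 by lia.
  rewrite sizeN in z'z.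
  have [_ /(_ z'm')[t tk [_ Et]]] := IH (- z') (leq_trans z'z zb); exists t => //.
  by rewrite Et; congr (_ + C _); ring.
- rewrite sizeN opprK => z' z'z z'm.
  have z'm' : 0 < - z' <= m%:Z by lia.
  rewrite sizeN in z'z.
  have [/(_ z'm')[s si [_ Es]] _] := IH (- z') (leq_trans z'z zb); exists s => //.
  by rewrite Es opprK; congr (_ + C _); ring.
exists t => //; split=> //.
by move: Et; rewrite opprK => ->; congr (_ + C _); ring.
Qed.

(** * Values of [C] on the low residues *)

Section Side.
Variables (C : int -> int) (alpha : int) (m Q N : nat) (e : int).
Variables (i k : nat) (v u : nat -> nat) (mid : nat -> Prop).
Hypothesis P : apery_profile C alpha m Q N e i k v u mid.

Local Notation c r := (C (Posz r)).

Lemma ap_dec (r : nat) : (1 <= r <= m)%N ->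
  exists2 s, (1 <= s <= i)%N & (v s <= r)%N /\ c r = c (v s) + c (r - v s)%N.
Proof.
move=> rm; have [+ _] := ap_dec_joint P (ltnSn (ap_size C alpha m Q N r%:Z)).
have r0 : 0 < r%:Z <= m%:Z by lia.
move=> /(_ r0)[s si [vr Er]]; exists s => //; split; first by lia.
by rewrite Er subzn.
Qed.

Lemma ap_subn (x y : nat) : c (x + y)%N <= c x + c y.
Proof. by rewrite /= PoszD; apply: ap_sub P _ _. Qed.

Lemma ap_topn (l : nat) : (1 <= l <= N)%N -> c (m + l)%N = e.
Proof. by move=> ll; rewrite /= PoszD (ap_top P). Qed.

Lemma ap_top_plateau s (l : nat) : (1 <= s <= i)%N -> (1 <= l <= N)%N ->
  e = C (v s)%:Z + C (m%:Z + l%:Z - (v s)%:Z) ->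
  (l <= v s)%N /\ e = c (v s) + c (m + l - v s)%N.
Proof.
move=> si ll E; have lv := ap_div_top_v P si ll E; split=> //.
by have [v1 vm] := ap_v P si; rewrite {1}E /= -subzn ?PoszD //; lia.
Qed.

(** A generator [v s <= r] dividing [r] also divides [m + l], whence [l <= v s <= r]. Thus the
    complementary residue [m + l - r] stays at most [m]. *)
Lemma ap_belown (r : nat) : (1 <= r <= m)%N ->
  exists2 l : nat, (1 <= l <= N)%N /\ (l <= r)%N & c r + c (m + l - r)%N = e.
Proof.
move=> rm; have [s si [vr Er]] := ap_dec rm.
have nr : ~~ ((m + Q + N + 1)%:Z %| r%:Z)%Z by apply: ndvdz_small; lia.
have [l ll El] := ap_below P nr; have El' := El.
have [] := @ap_trans _ _ _ _ _ _ _ _ _ _ _ P (v s)%:Z r%:Z (m%:Z + l%:Z).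
- by rewrite -subzn in Er.
- by rewrite (ap_top P).
rewrite (ap_top P) // => /(ap_top_plateau si ll)[lv _] _.
exists l; first by split=> //; lia.
by rewrite -El /= -subzn ?PoszD //; lia.
Qed.

Lemma ap_cv s : (1 <= s <= i)%N -> 1 <= c (v s).
Proof.
move=> si; have [v1 _] := ap_v P si; have vN := ap_vN P si.
exact: (ap_gt0 P v1 vN).
Qed.

(** If [r <= q + N], then [m - q + r] is a maximal residue. Otherwise removing from [r] a generator
    [v s < N] stays above [q] and lowers [C]. *)
Lemma ap_window (q r : nat) : (q < m)%N -> (q < r <= m)%N -> e <= c (m - q)%N + c r.
Proof.
move=> qm; elim/ltn_ind: r => r IH rm.
have [rq|rq] := leqP r (q + N).
  have ll : (1 <= r - q <= N)%N by lia.
  rewrite -(ap_topn ll); have -> : (m + (r - q) = m - q + r)%N by lia.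
  exact: ap_subn.
have rm' : (1 <= r <= m)%N by lia.
have [s si [vr Er]] := ap_dec rm'.
have [v1 _] := ap_v P si; have vN := ap_vN P si; have cv := ap_cv si.
have := IH (r - v s)%N; rewrite Er; lia.
Qed.

(** By [ap_belown], [m + l - x] complements [x] to exactly [e], whereas [ap_window] gives at least
    [e] with [x + 1] in place of [x]. *)
Lemma ap_mono1 (x : nat) : (1 <= x)%N -> (x < m)%N -> c x <= c x.+1.
Proof.
move=> x1 xm; have xm' : (1 <= x <= m)%N by lia.
have [l [ll lx] El] := ap_belown xm'.
have := @ap_window (m - x.+1)%N (m + l - x)%N.
have -> : (m - (m - x.+1) = x.+1)%N by lia.
lia.
Qed.

Lemma ap_mono (x y : nat) : (1 <= x)%N -> (x <= y)%N -> (y <= m)%N -> c x <= c y.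
Proof.
move=> x1; elim: y => [|y IH]; first by lia.
rewrite leq_eqVlt => /orP[/eqP-> //|xy] ym.
by have := IH xy (ltnW ym); have := @ap_mono1 y; lia.
Qed.

(** One inequality is [ap_window]. For the other, [m - q] has a complement [q + l] with [l >= 1],
    and [C] is nondecreasing. *)
Lemma ap_sym (q : nat) : (q < m)%N -> c (m - q)%N + c q.+1 = e.
Proof.
move=> qm; have qm' : (1 <= m - q <= m)%N by lia.
have [l [ll lx] El] := ap_belown qm'.
have := @ap_window q q.+1 qm; have := @ap_mono q.+1 (m + l - (m - q))%N; lia.
Qed.

Lemma ap_idx_le s : (0 < s <= i)%N -> (s <= v s)%N.
Proof.
elim: s => [//|[_|n IH]] ni; first by have [v1 _] := ap_v P ni.
have : (v n.+1 < v n.+2)%N by apply: (ap_vinc P); lia.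
have : (n < v n.+1)%N by apply: IH; lia.
by lia.
Qed.

(** A generator dividing [p] inherits the constant stretch ending at [p]. If [v s <= t], then [C]
    would drop by [C (v s) > 0] inside the stretch; otherwise subadditivity bounds [C (v s - t)]
    below by [C (v s)]. *)
Lemma ap_plateau_step (p t s : nat) : (t < p)%N -> (p <= m)%N -> c (p - t)%N = c p ->
  (1 <= s <= i)%N -> (v s <= p)%N -> c p = c (v s) + c (p - v s)%N ->
  (t < v s)%N /\ c (v s - t)%N = c (v s).
Proof.
move=> tp pm Et si vp Ev; have [v1 _] := ap_v P si; have cv := ap_cv si.
have [tv|vt] := ltnP t (v s); last first.
  have := @ap_mono (p - t)%N (p - v s)%N; lia.
split=> //; have := @ap_subn (v s - t)%N (p - v s)%N.
have -> : (v s - t + (p - v s) = p - t)%N by lia.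
have := @ap_mono (v s - t)%N (v s); lia.
Qed.

Lemma ap_vmono s t : (1 <= s)%N -> (s <= t)%N -> (t <= i)%N -> (v s <= v t)%N.
Proof.
by move=> s1; rewrite leq_eqVlt => /orP[/eqP-> //|st] ti; apply/ltnW/(ap_vinc P).
Qed.

Lemma ap_vlt s t : (1 <= s <= i)%N -> (1 <= t <= i)%N -> (v s < v t)%N -> (s < t)%N.
Proof. by move=> si ti; rewrite !ltnNge; apply: contra => ts; apply: ap_vmono; lia. Qed.

(* Each value [p - t, ..., p] of a constant stretch accounts for one more
   generator that is at most [p]. *)
Lemma ap_plateau (p t : nat) : (t < p)%N -> (p <= m)%N -> c (p - t)%N = c p ->
  (t < i)%N /\ (v t.+1 <= p)%N.
Proof.
elim/ltn_ind: p t => p IH t tp pm Et.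
have pm' : (1 <= p <= m)%N by lia.
have [s si [vp Ev]] := ap_dec pm'; have [v1 _] := ap_v P si.
have [tv Etv] := ap_plateau_step tp pm Et si vp Ev.
have [vp'|vp'] := ltnP (v s) p.
  by have [|ti vt] := IH _ vp' t tv _ Etv; [lia|split => //; lia].
(* When [p] is itself a generator, the stretch without its last point yields [t] generators below
   [p], and [p] is one more. *)
have Dp : p = v s by lia.
case: t tp Et tv {Etv} => [|t] tp Et tv; first by split; [lia|rewrite Dp; apply: ap_vmono; lia].
have Et' : c (p.-1 - t)%N = c p.-1.
  have := @ap_mono (p - t.+1)%N p.-1; have := @ap_mono p.-1 p.
  have -> : (p.-1 - t = p - t.+1)%N by lia.
  lia.
have [|||ti vt] := IH p.-1 _ t _ _ Et'; try lia.
have ts : (t.+1 < s)%N by apply: ap_vlt; lia.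
by split; [lia|rewrite Dp; apply: ap_vmono; lia].
Qed.

(** By [ap_sym], the cofactor [m + l - v s] is complemented to [e] by [v s - (l - 1)] as well as by
    [v s]. *)
Lemma ap_top_const s (l : nat) : (1 <= s <= i)%N -> (1 <= l <= N)%N ->
  e = C (v s)%:Z + C (m%:Z + l%:Z - (v s)%:Z) ->
  [/\ (l <= v s)%N, e = c (v s) + c (m + l - v s)%N & c (v s - l.-1)%N = c (v s)].
Proof.
move=> si ll E; have [lv E'] := ap_top_plateau si ll E; split => //.
have [v1 vm] := ap_v P si.
have := @ap_sym (v s - l)%N.
have -> : (m - (v s - l) = m + l - v s)%N by lia.
have -> : ((v s - l).+1 = v s - l.-1)%N by lia.
lia.
Qed.

(** The [l] equal values from [ap_top_const] account for [l] distinct low generators. *)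
Lemma ap_top_le s (l : nat) : (1 <= s <= i)%N -> (1 <= l <= N)%N ->
  e = C (v s)%:Z + C (m%:Z + l%:Z - (v s)%:Z) -> (l <= i)%N.
Proof.
move=> si ll E; have [lv _ Ec] := ap_top_const si ll E; have [v1 vm] := ap_v P si.
by have [||li _] := ap_plateau _ _ Ec; lia.
Qed.

Lemma ap_v1 : (0 < m)%N -> (0 < i)%N /\ v 1%N = 1%N.
Proof.
move=> m0; have [|s si [vs _]] := @ap_dec 1; first lia.
split; first lia; have [v1 _] := ap_v P si; have : (v 1%N <= v s)%N by apply: ap_vmono; lia.
by have [] := ap_v P (_ : 1 <= 1 <= i)%N; lia.
Qed.

Lemma ap_m_gt0 : (0 < i)%N -> (0 < m)%N.
Proof. by move=> i0; have [] := ap_v P (_ : 1 <= 1 <= i)%N; lia. Qed.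

(** A generator dividing [p - v s] divides [p], so uniqueness persists and [v s] can be removed
    repeatedly. *)
Lemma ap_power (p s : nat) : (1 <= s <= i)%N -> (0 < p <= m)%N ->
  (forall s', (1 <= s' <= i)%N -> (v s' <= p)%N -> c p = c (v s') + c (p - v s')%N ->
     s' = s) ->
  exists2 d : nat, (0 < d)%N & p = (d * v s)%N /\ c p = d%:Z * c (v s).
Proof.
move=> si; elim/ltn_ind: p => p IH pm only.
have [s' s'i [vp Ev]] := ap_dec pm.
have Ds := only s' s'i vp Ev; rewrite {}Ds {s' s'i} in vp Ev.
have [v1 _] := ap_v P si.
have [vp'|vp'] := ltnP (v s) p; last first.
  have Dp : p = v s by lia.
  by exists 1%N => //; rewrite Dp; split; lia.
have [||s' s'i vp2 Ev2|d d0 [Dp Ed]] := IH (p - v s)%N _ _ _; try lia.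
  apply: only => //; first lia.
  have := ap_subn (v s') (p - v s'); rewrite subnKC; last lia.
  have := ap_subn (v s) (p - v s - v s').
  have -> : (v s + (p - v s - v s') = p - v s')%N by lia.
  lia.
exists d.+1 => //; split; first lia.
by rewrite Ev Ed; lia.
Qed.

(** Without its last point the stretch at [v s] has [s - 1] equal values, ending at [v s - 1]. A
    generator dividing [v s - 1] has index below [s], and since it inherits this stretch,
    [ap_plateau] makes its index at least [s - 1]. Only one candidate remains, so [ap_power]
    applies. *)
Lemma ap_descend s : (1 < s <= i)%N -> c (v s - s.-1)%N = c (v s) ->
  c (v s.-1 - s.-2)%N = c (v s.-1) /\
  exists2 d : nat, (0 < d)%N & v s = (d * v s.-1).+1 /\ c (v s) = d%:Z * c (v s.-1).
Proof.
case: s => [|[|s]] //= si Es.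
have [v1 vm] : (1 <= v s.+2)%N /\ (v s.+2 <= m)%N by apply: (ap_v P); lia.
have vlt : (v s.+1 < v s.+2)%N by apply: (ap_vinc P).
have [v1' vm'] : (1 <= v s.+1)%N /\ (v s.+1 <= m)%N by apply: (ap_v P); lia.
have vs : (s.+1 < v s.+2)%N by apply: ap_idx_le; lia.
have Ep : c (v s.+2).-1 = c (v s.+2).
  have := @ap_mono (v s.+2 - s.+1)%N (v s.+2).-1; have := @ap_mono (v s.+2).-1 (v s.+2).
  lia.
have Et : c ((v s.+2).-1 - s)%N = c (v s.+2).-1.
  by rewrite Ep -Es; congr C; lia.
have step s' : (1 <= s' <= i)%N -> (v s' <= (v s.+2).-1)%N ->
    c (v s.+2).-1 = c (v s') + c ((v s.+2).-1 - v s')%N ->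
    s' = s.+1 /\ c (v s' - s)%N = c (v s').
  move=> s'i vs' Ev'.
  have [||tv Etv] := ap_plateau_step _ _ Et s'i vs' Ev'; try lia.
  have [v1s vms] := ap_v P s'i.
  have [si' vss] := ap_plateau tv vms Etv.
  have s's : (s' < s.+2)%N by apply: ap_vlt; lia.
  have ss' : (s.+1 <= s')%N by rewrite leqNgt; apply/negP => lt; have := ap_vinc P _ lt; lia.
  by split; first lia.
have pm : (0 < (v s.+2).-1 <= m)%N by lia.
split.
  by have [s' s'i [vs' Ev']] := ap_dec pm; have [Ds Ec] := step s' s'i vs' Ev'; rewrite Ds in Ec.
have [|s' s'i vs' Ev'|d d0 [Dp Ed]] := @ap_power _ s.+1 _ pm; first lia.
  by have [] := step s' s'i vs' Ev'.
by exists d => //; rewrite -Ep Ed; split => //; lia.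
Qed.

(** A low generator dividing [m + i] ends a stretch of [i] equal values and so is the last one,
    [v i]. From there [ap_power] and [ap_descend] produce the multiples one after another. *)
Lemma ap_chain : (0 < i)%N ->
  (exists2 s, (1 <= s <= i)%N & e = C (v s)%:Z + C (m%:Z + i%:Z - (v s)%:Z)) ->
  exists2 d : nat -> nat, forall s, (1 <= s <= i)%N -> (0 < d s)%N &
   [/\ (m + i = d i * v i)%N, e = (d i)%:Z * c (v i) &
       forall s, (1 <= s < i)%N -> v s.+1 = (d s * v s).+1 /\
                                   c (v s.+1) = (d s)%:Z * c (v s)].
Proof.
move=> i0 [s si Es].
have iN : (1 <= i <= N)%N.
  by have := @ap_idx_le i; have := @ap_vN _ _ _ _ _ _ _ _ _ _ _ P i; lia.
have only s' : (1 <= s' <= i)%N -> e = C (v s')%:Z + C (m%:Z + i%:Z - (v s')%:Z) ->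
    s' = i /\ c (v s' - i.-1)%N = c (v s').
  move=> s'i /(ap_top_const s'i iN)[iv _ Ec]; have [v1 vm] := ap_v P s'i.
  have [|_ vi] := ap_plateau _ vm Ec; first lia.
  split=> //; apply/eqP; rewrite eqn_leq; apply/andP; split; first lia.
  rewrite leqNgt; apply/negP => lt; have := ap_vinc P _ lt (leqnn i).
  rewrite prednK // in vi; lia.
have [Ds Ec] := only s si Es; rewrite {}Ds {s si} in Es Ec.
have ii : (1 <= i <= i)%N by lia.
have [vi Ee] := ap_top_plateau ii iN Es; have [v1 vm] := ap_v P ii.
(* [ap_power] only reaches residues up to [m], so one copy of [v i] is taken off first; hence the
   value [d.+1] at [i] below. *)
have pm : (0 < m + i - v i <= m)%N by lia.
have [s' s'i vs' Ev'|d d0 [Dp Ed]] := ap_power ii pm.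
  apply: (proj1 (only s' s'i _)).
  have := ap_sub P (v s')%:Z (m%:Z + i%:Z - (v s')%:Z).
  rewrite addrC subrK (ap_top P iN).
  have := ap_subn (v i) (m + i - v i - v s').
  have -> : (v i + (m + i - v i - v s'))%N = m%:Z + i%:Z - (v s')%:Z :> int by lia.
  lia.
have const s : (1 <= s <= i)%N -> c (v s - s.-1)%N = c (v s).
  move=> si; have -> : s = (i - (i - s))%N by lia.
  have : (i - s < i)%N by lia.
  elim: (i - s)%N => [|n IH] ni; first by rewrite subn0.
  have [||] := @ap_descend (i - n)%N; try lia.
  by rewrite !subnS.
exists (fun s => if s == i then d.+1 else (v s.+1).-1 %/ v s)%N => [s si|].
  case: eqP => [//|sni].
  have [||_ [d' d'0 [-> _]]] := @ap_descend s.+1; try lia; first by apply: const; lia.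
  by rewrite /= mulnK //; have [] := ap_v P si.
rewrite eqxx; split => [||s si]; first by lia.
  by rewrite Ee Ed; lia.
have -> : (s == i) = false by lia.
have [||_ [d' d'0 [E1 E2]]] := @ap_descend s.+1; try lia; first by apply: const; lia.
have [v1s _] : (1 <= v s)%N /\ (v s <= m)%N by apply: (ap_v P); lia.
by rewrite E2 E1 /= mulnK.
Qed.
End Side.

(** A generator with maximal residue divides no other maximal residue; the bounds on [l] come from
    [ap_top_le] and its reflection. *)
Lemma ap_top_gen C alpha m Q N e i k v u mid
    (P : apery_profile C alpha m Q N e i k v u mid) (l : nat) : (1 <= l <= N)%N ->
  [\/ (l <= i)%N /\ exists2 s, (1 <= s <= i)%N &
        e = C (v s)%:Z + C (m%:Z + l%:Z - (v s)%:Z),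
      (N < l + k)%N /\ exists2 t, (1 <= t <= k)%N &
        e = C (- (u t)%:Z) + C (m%:Z + l%:Z + (u t)%:Z) | mid l].
Proof.
move=> ll; have nl : ~~ ((m + Q + N + 1)%:Z %| m%:Z + l%:Z)%Z.
  by apply: ndvdz_small; lia.
have [y Ey [[s si ys]|[t tk yt]|[l' [l'l ml'] yl']]] := ap_gen P nl;
  rewrite (ap_top P ll) in Ey.
- rewrite ys in Ey; constructor 1; split; last by exists s.
  exact: (ap_top_le P si ll Ey).
- rewrite yt opprK in Ey; constructor 2; split; last by exists t.
  have lN : (1 <= N.+1 - l <= N)%N by lia.
  have := ap_top_le (ap_flip P) tk lN.
  have -> : - (Q%:Z + (N.+1 - l)%N%:Z - (u t)%:Z)
    = m%:Z + l%:Z + (u t)%:Z - (m + Q + N + 1)%:Z by lia.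
  have := ap_per P (m%:Z + l%:Z + (u t)%:Z - (m + Q + N + 1)%:Z); rewrite subrK; lia.
- have [->|ne] := eqVneq l l'; first by constructor 3.
  have nd : ~~ ((m + Q + N + 1)%:Z %| m%:Z + l%:Z - (m%:Z + l'%:Z))%Z.
    by apply: ndvdz_small; lia.
  by have := ap_max_proper P l'l nd; rewrite (ap_top P ll) -yl'; lia.
Qed.

(** * Positions of the generators among the maximal residues *)

Section Structure.
Variables (C : int -> int) (alpha : int) (m Q : nat) (e : int).
Variables (i j k : nat) (v u : nat -> nat) (mid : nat -> Prop) (l' : nat -> nat).
Local Notation N := (i + j + k)%N.
Hypothesis P : apery_profile C alpha m Q N e i k v u mid.
Hypothesis midE : forall l, mid l -> exists2 s, (1 <= s <= j)%N & l = l' s.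
Hypothesis l'inc : forall s t, (1 <= s)%N -> (s < t)%N -> (t <= j)%N -> (l' s < l' t)%N.

(** Since [i <= v i] and [k <= u k], the upper bounds on [v i], [u k] and their sum exclude
    [N = i + k]. *)
Lemma ap_j_gt0 : (0 < j)%N.
Proof.
have N2 := ap_N P; have Hi := @ap_idx_le _ _ _ _ _ _ _ _ _ _ _ P i.
have Hk := @ap_idx_le _ _ _ _ _ _ _ _ _ _ _ (ap_flip P) k.
have Hv := @ap_vN _ _ _ _ _ _ _ _ _ _ _ P i.
have Hu := @ap_uN _ _ _ _ _ _ _ _ _ _ _ P k.
have Huv := @ap_uv _ _ _ _ _ _ _ _ _ _ _ P i k.
lia.
Qed.

(** The indices [i + 1, ..., i + j] are out of reach of the low and high generators, so they all
    belong to middle ones; as only [j] of those exist, the two sorted lists coincide. *)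
Lemma ap_mid_index s : (1 <= s <= j)%N -> l' s = (i + s)%N.
Proof.
move=> sj.
have sub : {subset iota i.+1 j <= [seq l' s | s <- iota 1 j]}.
  move=> l; rewrite mem_iota => lij; have ll : (1 <= l <= N)%N by lia.
  case: (ap_top_gen P ll) => [[]|[]|/midE[t tj ->]]; [lia|lia|].
  by apply/map_f; rewrite mem_iota; lia.
have Hs : sorted ltn [seq l' s | s <- iota 1 j].
  rewrite sorted_map; have : sorted ltn (iota 1 j) by apply: iota_ltn_sorted.
  apply: (@sub_in_sorted _ [pred x | (1 <= x <= j)%N]); last first.
    by apply/allP => x; rewrite mem_iota inE; lia.
  by move=> x y; rewrite !inE => xj yj xy /=; apply: l'inc; lia.
have := uniq_min_size (iota_uniq _ _) sub; rewrite size_map !size_iota => /(_ (leqnn _)).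
move=> [_ /(irr_sorted_eq ltn_trans ltnn (iota_ltn_sorted _ _) Hs) E].
have := congr1 (nth 0%N ^~ s.-1) E; rewrite nth_iota; last lia.
rewrite (nth_map 0%N) ?size_iota; last lia.
rewrite nth_iota; last lia.
have -> : (1 + s.-1 = s)%N by lia.
lia.
Qed.

Lemma ap_top_i : (0 < i)%N ->
  exists2 s, (1 <= s <= i)%N & e = C (v s)%:Z + C (m%:Z + i%:Z - (v s)%:Z).
Proof.
move=> i0; have iN : (1 <= i <= N)%N by lia.
have j0 := ap_j_gt0.
case: (ap_top_gen P iN) => [[] //|[]|/midE[t tj]]; first by lia.
by rewrite ap_mid_index; lia.
Qed.

(** Stated in reflected form, as the hypothesis of [ap_chain] for [ap_flip P]. *)
Lemma ap_top_k : (0 < k)%N ->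
  exists2 t, (1 <= t <= k)%N & e + alpha = C (- (u t)%:Z) + C (- (Q%:Z + k%:Z - (u t)%:Z)).
Proof.
move=> k0; have kN : (1 <= N.+1 - k <= N)%N by lia.
have j0 := ap_j_gt0.
case: (ap_top_gen P kN) => [[]|[_ [t tk E]]|/midE[t tj]]; first by lia.
  exists t => //.
  have -> : - (Q%:Z + k%:Z - (u t)%:Z)
    = m%:Z + (N.+1 - k)%N%:Z + (u t)%:Z - (m + Q + N + 1)%:Z by lia.
  have := ap_per P (m%:Z + (N.+1 - k)%N%:Z + (u t)%:Z - (m + Q + N + 1)%:Z).
  by rewrite subrK; lia.
by rewrite ap_mid_index; lia.
Qed.

End Structure.

(** * Greedy expansions *)

Section Digits.
Variables (v d : nat -> nat) (i : nat).
Hypothesis v1 : (0 < i)%N -> v 1%N = 1%N.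
Hypothesis vS : forall s, (1 <= s < i)%N -> v s.+1 = (d s * v s).+1.

(** Digit vectors of greedy expansions in the base [v]: a full digit [d s] occurs only when all
    lower digits vanish. *)
Definition greedy (E : nat -> nat) : Prop :=
  (forall s, (1 <= s <= i)%N -> (E s <= d s)%N) /\
  (forall s t, (1 <= t)%N -> (t < s)%N -> (s <= i)%N -> (0 < E t)%N -> (E s < d s)%N).

Definition digit_sum (E : nat -> nat) (s : nat) : nat :=
  (\sum_(1 <= t < s.+1) E t * v t)%N.

Lemma digit_sum0 E : digit_sum E 0 = 0%N.
Proof. by rewrite /digit_sum big_geq. Qed.

Lemma digit_sumS E s : digit_sum E s.+1 = (digit_sum E s + E s.+1 * v s.+1)%N.
Proof. by rewrite /digit_sum big_nat_recr. Qed.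

Lemma digit_sum_eq0 E s : (forall t, (1 <= t <= s)%N -> E t = 0%N) -> digit_sum E s = 0%N.
Proof.
move=> E0; rewrite /digit_sum big_nat_cond big1 // => t; rewrite andbT => ts.
by rewrite E0 //; lia.
Qed.

(** If the top digit is full, the lower ones vanish; otherwise the lower part is less than one unit
    of the top place. *)
Lemma digit_sum_lt E s : greedy E -> (s < i)%N ->
  (digit_sum E s < v s.+1)%N /\ (digit_sum E s.+1 <= d s.+1 * v s.+1)%N.
Proof.
move=> [Ed El]; elim: s => [|s IH] si.
  rewrite digit_sumS digit_sum0 v1 //; split=> //.
  by have := Ed 1%N; lia.
have [] := IH (ltnW si) => IH1 IH2.
have lt : (digit_sum E s.+1 < v s.+2)%N by rewrite vS // ltnS.
split=> //; rewrite digit_sumS.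
have Eds : (E s.+2 <= d s.+2)%N by apply: Ed; lia.
have [lt2|ge2] := ltnP (E s.+2) (d s.+2); first by nia.
rewrite digit_sum_eq0 => [|t ts]; first by rewrite add0n leq_mul2r Eds orbT.
have := El s.+2 t; lia.
Qed.

(** Euclidean division by the largest [v] recovers the top digit. *)
Lemma digit_sum_inj E E' : greedy E -> greedy E' ->
  digit_sum E i = digit_sum E' i -> forall t, (1 <= t <= i)%N -> E t = E' t.
Proof.
move=> gE gE'; suff H s : (s <= i)%N -> digit_sum E s = digit_sum E' s ->
    forall t, (1 <= t <= s)%N -> E t = E' t by exact: H.
elim: s => [|s IH] si; first by lia.
have [lt _] := digit_sum_lt gE si; have [lt' _] := digit_sum_lt gE' si.
rewrite !digit_sumS => eq.
have EE : E s.+1 = E' s.+1.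
  have v0 : (0 < v s.+1)%N by lia.
  have := congr1 (divn^~ (v s.+1)) eq.
  by rewrite ![(_ + _ * v _)%N]addnC !divnMDl // !divn_small // !addn0.
move=> t ts; have [-> //|ne] := eqVneq t s.+1.
by apply: IH; lia.
Qed.

End Digits.

(** * Monomials modulo the minors *)

(* Column [s] of the matrix is [(Y_s ^ topexp s ; Y_(s+1) ^ botexp s)], where
   [Y_0, ..., Y_(i+j+k)] are the variables in order and [Y_(i+j+k+1) = Y_0]. *)
Definition topexp (i : nat) (c : nat -> nat) (s : nat) : nat :=
  if (s <= i)%N then c s else 1%N.

Definition botexp (i j k : nat) (c'' : nat -> nat) (s : nat) : nat :=
  if (s < i + j)%N then 1%N else if (s < i + j + k)%N then c'' (s - (i + j)).+1
  else c'' 0%N.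

(* Exponents of monomials divisible by no [top b * bottom a] with [a < b], the
   initial monomials of the minors for the lexicographic order. *)
Definition standard (N : nat) (p q E : nat -> nat) : Prop :=
  forall a b, (a < b <= N)%N ->
    ~ (forall x, (x <= N)%N -> (p b * (x == b) + q a * (x == a.+1) <= E x)%N).

Section Standard.
Variables (i j k : nat) (c c'' v u : nat -> nat) (m Q : nat).
Local Notation N := (i + j + k)%N.
Hypothesis v1 : (0 < i)%N -> v 1%N = 1%N.
Hypothesis vS : forall s, (1 <= s < i)%N -> v s.+1 = (c s * v s).+1.
Hypothesis v_last : if i is 0 then m = 0%N else (m + i = c i * v i)%N.
Hypothesis u1 : (0 < k)%N -> u 1%N = 1%N.
Hypothesis uS : forall s, (1 <= s < k)%N -> u s.+1 = (c'' (k.+1 - s) * u s).+1.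
Hypothesis u_last : if k is 0 then Q = 0%N else (Q + k = c'' 1%N * u k)%N.

Local Notation standardE := (standard N (topexp i c) (botexp i j k c'')).

(** Signed representatives: high generators get negative residues, and [u] counts them from the
    outside, whence the index [N + 1 - s]. *)
Definition residue (s : nat) : int :=
  if s == 0%N then 0 else if (s <= i)%N then (v s)%:Z
  else if (s <= i + j)%N then (m + s)%N%:Z else - (u (N.+1 - s))%:Z.

(** The top of column [y] is [Y_y] and the bottom of column [x - 1] is [Y_x], so their product is
    excluded. *)
Lemma standard_excl E x y : standardE E -> (1 <= x <= i + j)%N -> (i < y <= N)%N ->
  (x < y)%N -> (0 < E x)%N -> (0 < E y)%N -> False.
Proof.
move=> sE xlo yhi xy Ex Ey; have ab : (x.-1 < y <= N)%N by lia.
apply: (sE _ _ ab) => z zN; rewrite /topexp /botexp.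
have -> : (y <= i)%N = false by lia.
have -> : (x.-1 < i + j)%N = true by lia.
have [->|zy] := eqVneq z y; first by have -> : (y == x.-1.+1) = false by lia.
by have [->|zx] := eqVneq z x.-1.+1; rewrite ?prednK //; lia.
Qed.

Lemma standard_mid E x : standardE E -> (i < x <= i + j)%N -> (E x <= 1)%N.
Proof.
move=> sE xm; rewrite leqNgt; apply/negP => Ex; have ab : (x.-1 < x <= N)%N by lia.
apply: (sE _ _ ab) => z zN; rewrite /topexp /botexp.
have -> : (x <= i)%N = false by lia.
have -> : (x.-1 < i + j)%N = true by lia.
have -> : x.-1.+1 = x by lia.
by have [->|zx] := eqVneq z x; lia.
Qed.

(** The excluded product is the top of column [s], a power of [Y_s], times the bottom [Y_t] of
    column [t - 1]. *)
Lemma standard_lo E t s : standardE E -> (1 <= t <= s)%N -> (s <= i)%N ->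
  (c s + (t == s) <= E s)%N -> (0 < E t)%N -> False.
Proof.
move=> sE ts si Es Et; have ab : (t.-1 < s <= N)%N by lia.
apply: (sE _ _ ab) => z zN; rewrite /topexp /botexp si.
have -> : (t.-1 < i + j)%N = true by lia.
have -> : t.-1.+1 = t by lia.
have [->|zs] := eqVneq z s; first by rewrite eq_sym in Es; lia.
by have [->|zt] := eqVneq z t; lia.
Qed.

(** Here the power of [Y_x] is the bottom of column [x - 1], and [Y_y] is the top of column [y]. *)
Lemma standard_hi E x y : standardE E -> (i + j < x <= y)%N -> (y <= N)%N ->
  (c'' (x - (i + j)) + (x == y) <= E x)%N -> (0 < E y)%N -> False.
Proof.
move=> sE xy yN Ex Ey; have ab : (x.-1 < y <= N)%N by lia.
apply: (sE _ _ ab) => z zN; rewrite /topexp /botexp.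
have -> : (y <= i)%N = false by lia.
have -> : (x.-1 < i + j)%N = false by lia.
have -> : (x.-1 < N)%N = true by lia.
have -> : ((x.-1 - (i + j)).+1 = x - (i + j))%N by lia.
have -> : x.-1.+1 = x by lia.
have [->|zx] := eqVneq z x; first by lia.
by have [->|zy] := eqVneq z y; lia.
Qed.

Lemma standard_greedy_lo E : standardE E -> greedy c i E.
Proof.
move=> sE; split=> [s si|s t t1 ts si Et].
  rewrite leqNgt; apply/negP => lt.
  by apply: (@standard_lo E s s sE); rewrite ?eqxx; lia.
rewrite ltnNge; apply/negP => ge.
by apply: (@standard_lo E t s sE); lia.
Qed.

Lemma standard_greedy_hi E : standardE E ->
  greedy (fun t => c'' (k.+1 - t)) k (fun t => E (N.+1 - t)%N).
Proof.
have sub t : (1 <= t <= k)%N -> (k.+1 - t = N.+1 - t - (i + j))%N by lia.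
move=> sE; split=> [s si|s t t1 ts si Et].
  rewrite leqNgt; apply/negP => lt.
  by apply: (@standard_hi E (N.+1 - s) (N.+1 - s) sE); rewrite -?sub ?eqxx; lia.
rewrite ltnNge; apply/negP => ge.
by apply: (@standard_hi E (N.+1 - s) (N.+1 - t) sE); rewrite -?sub; lia.
Qed.

Definition residue_sum (E : nat -> nat) : int :=
  \sum_(0 <= s < N.+1) (E s)%:Z * residue s.

Local Notation lo_sum E := (digit_sum v E i).
Local Notation hi_sum E := (digit_sum u (fun t => E (N.+1 - t)%N) k).

Lemma residue_sumE E : residue_sum E = (lo_sum E)%:Z
  + (\sum_(i.+1 <= s < (i + j).+1) E s * (m + s))%N%:Z - (hi_sum E)%:Z.
Proof.
have R0 : residue 0%N = 0 by [].
rewrite /residue_sum (@big_ltn _ _ _ 0) // R0 mulr0 add0r.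
rewrite (@big_cat_nat _ _ _ i.+1) /=; [|lia|lia].
rewrite [X in _ + X](@big_cat_nat _ _ _ (i + j).+1) /=; [|lia|lia].
rewrite addrA /digit_sum !(big_morph Posz PoszD (erefl 0%:Z)) -sumrN; congr (_ + _ + _).
- apply: eq_big_nat => s si; rewrite PoszM /residue.
  have -> : (s == 0%N) = false by lia.
  by have -> : (s <= i)%N = true by lia.
- apply: eq_big_nat => s si; rewrite PoszM /residue.
  have -> : (s == 0%N) = false by lia.
  have -> : (s <= i)%N = false by lia.
  by have -> : (s <= i + j)%N = true by lia.
rewrite -[(i + j).+1]add1n big_addn big_nat_rev /=.
have -> : (N.+1 - (i + j) = k.+1)%N by lia.
apply: eq_big_nat => s si; rewrite PoszM /residue.
have -> : (1 + k.+1 - s.+1 + (i + j) = N.+1 - s)%N by lia.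
have -> : (N.+1 - s == 0)%N = false by lia.
have -> : (N.+1 - s <= i)%N = false by lia.
have -> : (N.+1 - s <= i + j)%N = false by lia.
have -> : (N.+1 - (N.+1 - s) = s)%N by lia.
by rewrite mulrN.
Qed.

Lemma lo_sum_le E : standardE E -> (lo_sum E <= m + i)%N.
Proof.
move=> /standard_greedy_lo gE; move: v1 vS v_last gE.
case: i => [|n] V1 VS Vl gE; first by rewrite digit_sum0.
by have [_] := digit_sum_lt V1 VS gE (ltnSn n); rewrite Vl.
Qed.

Lemma hi_sum_le E : standardE E -> (hi_sum E <= Q + k)%N.
Proof.
move=> /standard_greedy_hi; move: (fun t => E (N.+1 - t)%N) => F gE.
move: u1 uS u_last gE; case: k => [|n] V1 VS Vl gE; first by rewrite digit_sum0.
have [_] := digit_sum_lt V1 VS gE (ltnSn n); rewrite Vl.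
by have -> : (n.+2 - n.+1 = 1)%N by lia.
Qed.

Definition has_mid (E : nat -> nat) (x : nat) : Prop :=
  [/\ (i < x <= i + j)%N, E x = 1%N & forall s, (1 <= s <= N)%N -> s != x -> E s = 0%N].

Lemma standard_cases E : standardE E ->
  (exists2 x, has_mid E x & residue_sum E = (m + x)%N%:Z) \/
  [/\ forall s, (i < s <= i + j)%N -> E s = 0%N,
     residue_sum E = (lo_sum E)%:Z - (hi_sum E)%:Z &
     lo_sum E = 0%N \/ hi_sum E = 0%N].
Proof.
move=> sE; have [/hasP[x]|] := boolP (has (fun x => (0 < E x)%N) (iota i.+1 j)).
  rewrite mem_iota => xm Ex; left; have xij : (i < x <= i + j)%N by lia.
  have E0 s : (1 <= s <= N)%N -> s != x -> E s = 0%N.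
    move=> sN sx; apply/eqP; rewrite -leqn0 leqNgt; apply/negP => Es.
    have [lt|ge] := ltnP s x; first by apply: (standard_excl sE _ _ lt Es Ex); lia.
    have lt : (x < s)%N by lia.
    by apply: (standard_excl sE _ _ lt Ex Es); lia.
  have Ex1 : E x = 1%N by have := standard_mid sE xij; lia.
  exists x; first by split.
  rewrite residue_sumE !digit_sum_eq0; try by move=> t ti; apply: E0; lia.
  rewrite subr0 add0r (@big_cat_nat _ _ _ x) /=; [|lia|lia].
  rewrite [X in (X + _)%N]big_nat_cond big1 => [|t ti]; last by rewrite E0; lia.
  rewrite big_ltn; last lia.
  rewrite Ex1 [X in (_ + (_ + X))%N]big_nat_cond big1 => [|t ti]; last by rewrite E0; lia.
  by rewrite mul1n add0n addn0.
move=> /hasPn E0; right; have mid0 s : (i < s <= i + j)%N -> E s = 0%N.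
  by move=> sij; have := E0 s; rewrite mem_iota; lia.
split=> //.
  have mid_sum0 : (\sum_(i.+1 <= s < (i + j).+1) E s * (m + s) = 0)%N.
    by rewrite big_nat_cond big1 // => s sij; rewrite mid0; lia.
  by rewrite residue_sumE mid_sum0 addr0.
have [/hasP[x]|/hasPn lo0] := boolP (has (fun x => (0 < E x)%N) (iota 1 i)).
  rewrite mem_iota => xm Ex; right; apply: digit_sum_eq0 => t tk.
  apply/eqP; rewrite -leqn0 leqNgt; apply/negP => Et.
  by apply: (@standard_excl E x (N.+1 - t) sE); lia.
left; apply: digit_sum_eq0 => t ti; have := lo0 t; rewrite mem_iota; lia.
Qed.

(** Residues of standard monomials lie between [- (Q + k)] and [m + i + j], a range shorter than
    [a0], so congruent ones are equal. Values above [m + i] come from a single middle variable, the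
    others from a greedy expansion on one side. *)
Lemma standard_unique E E' : standardE E -> standardE E' ->
  ((m + Q + N + 1)%:Z %| residue_sum E - residue_sum E')%Z ->
  forall s, (1 <= s <= N)%N -> E s = E' s.
Proof.
move=> sE sE' dvd; have lE := lo_sum_le sE; have lE' := lo_sum_le sE'.
have hE := hi_sum_le sE; have hE' := hi_sum_le sE'; have eqR : residue_sum E = residue_sum E'.
  apply/eqP; rewrite -subr_eq0; apply: contraLR dvd => ne.
  apply: ndvdz_small => //.
  have [[x [xm _ _] ->]|[_ -> _]] := standard_cases sE;
    have [[x' [x'm _ _] ->]|[_ -> _]] := standard_cases sE'; lia.
move=> s sN.
have [[x [xm Ex E0] Rx]|[mid0 R0 lh]] := standard_cases sE;
  have [[x' [x'm Ex' E0'] Rx']|[mid0' R0' lh']] := standard_cases sE'; try lia.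
  have Dx : x' = x by lia.
  rewrite {}Dx in Ex' E0'.
  by have [->|sx] := eqVneq s x; [rewrite Ex|rewrite E0 ?E0'; lia].
have [si|si] := leqP s i.
  apply: (digit_sum_inj v1 vS (standard_greedy_lo sE) (standard_greedy_lo sE')); lia.
have [sij|sij] := leqP s (i + j); first by rewrite mid0 ?mid0'; lia.
have := @digit_sum_inj _ _ _ u1 uS _ _ (standard_greedy_hi sE) (standard_greedy_hi sE').
move=> /(_ _ (N.+1 - s)%N); have -> : (N.+1 - (N.+1 - s) = s)%N by lia.
by apply; lia.
Qed.
End Standard.

(** * Closure properties of generated ideals *)

Section IdealGenerated.
Variables (R : comNzRingType) (A : R -> Prop).

Lemma ideal_generated0 : ideal_generated A 0.
Proof. by exists [::] => //; rewrite big_nil. Qed.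

Lemma ideal_generated_mem x : A x -> ideal_generated A x.
Proof.
move=> Ax; exists [:: (1, x)]; last by rewrite big_seq1 mul1r.
by move=> y; rewrite inE => /eqP->.
Qed.

Lemma ideal_generatedD x y :
  ideal_generated A x -> ideal_generated A y -> ideal_generated A (x + y).
Proof.
move=> [s As ->] [t At ->]; exists (s ++ t); last by rewrite big_cat.
by move=> w; rewrite mem_cat => /orP[/As|/At].
Qed.

Lemma ideal_generatedM r x : ideal_generated A x -> ideal_generated A (r * x).
Proof.
move=> [s As ->]; exists [seq (r * w.1, w.2) | w <- s].
  by move=> w /mapP[w' w's ->]; exact: (As _ w's).
by rewrite mulr_sumr big_map; apply: eq_bigr => w _; rewrite mulrA.
Qed.

Lemma ideal_generatedN x : ideal_generated A x -> ideal_generated A (- x).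
Proof. by move=> Ax; rewrite -mulN1r; apply: ideal_generatedM. Qed.

Lemma ideal_generated_trans x y z : ideal_generated A (x - y) ->
  ideal_generated A (y - z) -> ideal_generated A (x - z).
Proof. by move=> xy yz; rewrite -(subrKA y); apply: ideal_generatedD. Qed.

Lemma ideal_generated_sum (I : eqType) (s : seq I) (F : I -> R) :
  (forall w, w \in s -> ideal_generated A (F w)) -> ideal_generated A (\sum_(w <- s) F w).
Proof.
move=> AF; rewrite big_seq; apply: big_ind AF => //.
  exact: ideal_generated0.
exact: ideal_generatedD.
Qed.

Lemma ideal_generated_ind (J : R -> Prop) : J 0 -> (forall x y, J x -> J y -> J (x + y)) ->
  (forall r x, A x -> J (r * x)) -> forall x, ideal_generated A x -> J x.
Proof.
move=> J0 JD JM x [s As ->]; rewrite big_seq; apply: big_ind => // w ws.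
exact/JM/As.
Qed.

End IdealGenerated.

(** The vectors are read as numerals in base [M]: the digits of [f] after place [a] are together
    worth less than one unit of that place. *)
Lemma lex_number_lt (N M a : nat) (f f' : nat -> nat) : (a <= N)%N ->
  (forall x, (x < a)%N -> f x = f' x) -> (f a < f' a)%N ->
  (forall x, (x <= N)%N -> (f x < M)%N) ->
  (\sum_(0 <= x < N.+1) f x * M ^ (N - x) < \sum_(0 <= x < N.+1) f' x * M ^ (N - x))%N.
Proof.
move=> aN eq lt fM.
have tail b : (b <= N.+1)%N ->
    (\sum_(b <= x < N.+1) f x * M ^ (N - x) < M ^ (N.+1 - b))%N.
  move=> bN; have -> : b = (N.+1 - (N.+1 - b))%N by lia.
  have : (N.+1 - b <= N.+1)%N by lia.
  elim: (N.+1 - b)%N => [|n IH] nN; first by rewrite big_geq ?subn0 // subnn expn0.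
  rewrite big_ltn; last by lia.
  have -> : (N.+1 - n.+1).+1 = (N.+1 - n)%N by lia.
  have -> : (N - (N.+1 - n.+1) = n)%N by lia.
  have := IH (ltnW nN); have -> : (N.+1 - (N.+1 - n) = n)%N by lia.
  have -> : (N.+1 - (N.+1 - n.+1) = n.+1)%N by lia.
  have := fM (N.+1 - n.+1)%N; rewrite expnS.
  move: (f _) (\sum_(_ <= x < _) _)%N (M ^ n)%N => A B D; nia.
rewrite !(@big_cat_nat _ _ _ a 0 N.+1) //=; try lia.
rewrite [X in (X + _ < _)%N](_ : _ = \sum_(0 <= x < a) f' x * M ^ (N - x))%N; last first.
  by apply: eq_big_nat => x xa; rewrite eq.
rewrite ltn_add2l !(@big_ltn _ _ _ a) ?ltnS //.
have := tail a.+1; rewrite subSS => /(_ aN).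
move: (\sum_(_ <= x < _) f x * _)%N (\sum_(_ <= x < _) f' x * _)%N (M ^ _)%N => A B D; nia.
Qed.

(** * Reduction of a monomial to a standard one *)

Section Rewriting.
Variables (K : fieldType) (N : nat) (p q g : nat -> nat).
Variable A : {mpoly K[N.+1]} -> Prop.
Local Notation J := (ideal_generated A).

Definition cyc_next (s : nat) : nat := if (s < N)%N then s.+1 else 0.
Definition top_mnm (s : nat) : 'X_{1..N.+1} := (U_(inord s) *+ p s)%MM.
Definition bot_mnm (s : nat) : 'X_{1..N.+1} := (U_(inord (cyc_next s)) *+ q s)%MM.
Definition mnm_weight (mm : 'X_{1..N.+1}) : nat := (\sum_(x < N.+1) mm x * g x)%N.
Definition mnm_exp (mm : 'X_{1..N.+1}) (x : nat) : nat := mm (inord x).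

Hypothesis p_gt0 : forall s, (s <= N)%N -> (0 < p s)%N.
Hypothesis q_gt0 : forall s, (s <= N)%N -> (0 < q s)%N.
Hypothesis g_gt0 : forall s, (s <= N)%N -> (0 < g s)%N.
Hypothesis balanced : forall a b, (a < b <= N)%N ->
  (p a * g a + q b * g (cyc_next b) = p b * g b + q a * g (cyc_next a))%N.
Hypothesis minorsA : forall a b, (a < b <= N)%N ->
  J ('X_[top_mnm a + bot_mnm b] - 'X_[top_mnm b + bot_mnm a]).

Lemma mnm_weightD m1 m2 : mnm_weight (m1 + m2)%MM = (mnm_weight m1 + mnm_weight m2)%N.
Proof. by rewrite -big_split; apply: eq_bigr => x _; rewrite mnmDE mulnDl. Qed.

Lemma mnm_weightU s d : (s <= N)%N -> mnm_weight (U_(inord s) *+ d)%MM = (d * g s)%N.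
Proof.
move=> sN; rewrite /mnm_weight (bigD1 (inord s)) //= big1 => [|x xs].
  by rewrite mulmnE mnm1E eqxx mul1n addn0 inordK.
by rewrite mulmnE mnm1E eq_sym (negbTE xs).
Qed.

Lemma mnm_expU s d x : (s <= N)%N -> (x <= N)%N ->
  mnm_exp (U_(inord s) *+ d)%MM x = (d * (x == s))%N.
Proof.
move=> sN xN; rewrite /mnm_exp mulmnE mnm1E mulnC; congr (_ * nat_of_bool _)%N.
by apply/eqP/eqP => [/(congr1 (@nat_of_ord _))|->//]; rewrite !inordK.
Qed.

Lemma cyc_next_le s : (cyc_next s <= N)%N.
Proof. by rewrite /cyc_next; case: ifP. Qed.

Lemma mnm_exp_weight mm x : (x <= N)%N -> (mnm_exp mm x <= mnm_weight mm)%N.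
Proof.
move=> xN; rewrite /mnm_weight (bigD1 (inord x)) //= inordK // /mnm_exp.
by have := g_gt0 xN; nia.
Qed.

(* Rewriting [top b * bottom a] to [top a * bottom b] for [a < b] increases the
   exponent vector lexicographically, also in the last column, whose bottom is a
   power of [Y_0]. *)
Lemma standard_form mm : exists mm' : 'X_{1..N.+1},
  [/\ standard N p q (mnm_exp mm'), mnm_weight mm' = mnm_weight mm
    & J ('X_[mm] - 'X_[mm'])].
Proof.
(* Rewriting keeps the weight and all degrees are positive, so exponents stay below [M]; the numeral
   [num] is bounded and grows at each step, which gives termination. *)
pose M := (mnm_weight mm).+1.
pose num (m1 : 'X_{1..N.+1}) := (\sum_(0 <= x < N.+1) mnm_exp m1 x * M ^ (N - x))%N.
pose bound := (\sum_(0 <= x < N.+1) M * M ^ (N - x))%N.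
have num_le m1 : mnm_weight m1 = mnm_weight mm -> (num m1 <= bound)%N.
  move=> w1; rewrite /num /bound !big_mkord; apply: leq_sum => x _.
  rewrite leq_mul2r; apply/orP; right; rewrite /M -w1.
  by rewrite (leq_trans (mnm_exp_weight _ _)) // -ltnS.
suff H n m1 : mnm_weight m1 = mnm_weight mm -> (bound - num m1 < n)%N ->
    exists mm' : 'X_{1..N.+1}, [/\ standard N p q (mnm_exp mm'),
      mnm_weight mm' = mnm_weight mm & J ('X_[m1] - 'X_[mm'])].
  exact: H (ltnSn _).
elim: n m1 => // n IH m1 w1 ltn1.
have [|/existsPn nostd] := boolP [exists a : 'I_N.+1, [exists b : 'I_N.+1,
    (a < b)%N && [forall x : 'I_N.+1, p b * (x == b :> nat) + q a * (x == a.+1 :> nat)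
      <= mnm_exp m1 x]%N]]; last first.
  exists m1; split=> //; last by rewrite subrr; apply: ideal_generated0.
  move=> a b abN Hx; have aN : (a < N.+1)%N by lia.
  have bN : (b < N.+1)%N by lia.
  move: (nostd (Ordinal aN)) => /existsPn/(_ (Ordinal bN)).
  rewrite negb_and /= => /orP[/negP|/forallPn[x /negP]]; first by lia.
  by apply; apply: Hx; rewrite -ltnS.
move=> /existsP[a /existsP[b /andP[ab /forallP Hx]]].
have abN : (a < b <= N)%N by rewrite ab -ltnS ltn_ord.
have aN : (a <= N)%N by lia.
have bN : (b <= N)%N by lia.
have expB x : (x <= N)%N -> mnm_exp (top_mnm b + bot_mnm a)%MM x
    = (p b * (x == b) + q a * (x == a.+1))%N.
  move=> xN; rewrite {1}/mnm_exp mnmDE -!/(mnm_exp _ _) !mnm_expU ?cyc_next_le //.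
  by rewrite /cyc_next; have -> : (a < N)%N by lia.
have le : (top_mnm b + bot_mnm a <= m1)%MM.
  apply/mnm_lepP => x; have xN : (x <= N)%N by rewrite -ltnS.
  by have := Hx x; rewrite -expB // /mnm_exp inord_val.
pose m2 := (m1 - (top_mnm b + bot_mnm a) + (top_mnm a + bot_mnm b))%MM.
have w2 : mnm_weight m2 = mnm_weight mm.
  rewrite /m2 -w1 -[in RHS](submK le) !mnm_weightD !mnm_weightU ?cyc_next_le //.
  by rewrite balanced.
have exp2 x : (x <= N)%N -> mnm_exp m2 x =
    (mnm_exp m1 x - (p b * (x == b) + q a * (x == a.+1))
      + (p a * (x == a) + q b * (x == cyc_next b)))%N.
  move=> xN; rewrite -expB // -!mnm_expU ?cyc_next_le //.
  by rewrite /m2 /mnm_exp !(mnmDE, mnmBE).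
have lt12 : (num m1 < num m2)%N.
  have := (p_gt0 aN, q_gt0 bN); case=> pa qb.
  (* The first exponent to change is that of [Y_a], except that for [b = N] the new bottom raises
     the exponent of [Y_0]. *)
  apply: (@lex_number_lt N M (if b == N :> nat then 0 else a)%N) => [|x||x xN].
  - by case: ifP.
  - have [bE|bE] := eqVneq (b : nat) N; first by [].
    move=> xa; rewrite exp2 /cyc_next; last by lia.
    have -> : (b < N)%N by lia.
    have -> : (x == b) = false by lia.
    have -> : (x == a.+1) = false by lia.
    have -> : (x == a) = false by lia.
    have -> : (x == b.+1) = false by lia.
    by rewrite /= !muln0 subn0 !addn0.
  - have := exp2 (if b == N :> nat then 0 else a)%N.
    have [bE|bE] := eqVneq (b : nat) N; rewrite /cyc_next.
      have -> : (b < N)%N = false by lia.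
      move=> -> //; have -> : (0%N == b) = false by lia.
      by rewrite eqxx; lia.
    move=> -> //; have -> : (a == b :> nat) = false by lia.
    have -> : (a == a.+1 :> nat) = false by lia.
    by rewrite eqxx; lia.
  - by rewrite /M -w1 ltnS mnm_exp_weight.
have [|mm' [std' w' J']] := IH m2 w2; first by have := num_le m2 w2; lia.
exists mm'; split=> //; apply: ideal_generated_trans J'.
rewrite -{1}(submK le) /m2 !(mpolyXD _ (m1 - _)) -mulrBr; apply: ideal_generatedM.
rewrite -opprB; apply: ideal_generatedN; exact: minorsA.
Qed.

End Rewriting.

(** * The kernel of a monomial map *)

Section Toric.
Variables (K : fieldType) (N : nat) (g : nat -> nat) (A : {mpoly K[N.+1]} -> Prop).
Local Notation J := (ideal_generated A).

Definition toric_map : {mpoly K[N.+1]} -> {poly K} :=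
  mmap (@polyC K) (fun r : 'I_N.+1 => 'X^(g r)).

Lemma toric_mmap1 (mm : 'X_{1..N.+1}) :
  mmap1 (fun r : 'I_N.+1 => 'X^(g r) : {poly K}) mm = 'X^(mnm_weight g mm).
Proof.
rewrite /mmap1 /mnm_weight (big_morph _ (exprD 'X) (expr0 'X)).
by apply: eq_bigr => x _; rewrite -exprM mulnC.
Qed.

Lemma toric_mapX mm : toric_map 'X_[mm] = 'X^(mnm_weight g mm).
Proof. by rewrite /toric_map mmapX toric_mmap1. Qed.

(** In the kernel the coefficients of each degree sum to zero, so replacing every monomial by a
    representative of its degree gives zero. The polynomial is thus a combination of differences of
    monomials of equal degree. *)
Lemma toric_ideal (pol : {mpoly K[N.+1]}) :
  (forall m1 m2 : 'X_{1..N.+1}, mnm_weight g m1 = mnm_weight g m2 -> J ('X_[m1] - 'X_[m2])) ->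
  toric_map pol = 0 -> J pol.
Proof.
move=> same ker0; pose w (mm : 'X_{1..N.+1}) := mnm_weight g mm.
(* The first monomial of degree [d] in the support; the default [0%MM] is returned only for degrees
   absent from it. *)
pose rep d := nth 0%MM (msupp pol) (find (fun mm => w mm == d) (msupp pol)).
have w_rep mm : mm \in msupp pol -> w (rep (w mm)) = w mm.
  move=> mms; apply/eqP.
  have /(nth_find 0%MM) : has (fun m1 => w m1 == w mm) (msupp pol).
    by apply/hasP; exists mm.
  by [].
pose D := (\sum_(mm <- msupp pol) w mm).+1.
have w_lt mm : mm \in msupp pol -> (w mm < D)%N.
  by move=> mms; rewrite ltnS (big_rem mm) //= leq_addr.
have fiber0 d : \sum_(mm <- msupp pol | w mm == d) pol@_mm = 0.
  transitivity ((toric_map pol)`_d); last by rewrite ker0 coef0.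
  rewrite /toric_map /mmap coef_sum.
  rewrite big_mkcond /=; apply: eq_bigr => mm _; rewrite coefCM toric_mmap1 coefXn -/(w mm) eq_sym.
  by case: eqP => _; rewrite ?mulr1 ?mulr0.
have sum0 : \sum_(mm <- msupp pol) pol@_mm *: 'X_[rep (w mm)] = 0 :> {mpoly K[N.+1]}.
  transitivity (\sum_(mm <- msupp pol) \sum_(d < D | w mm == d :> nat)
      pol@_mm *: 'X_[rep d] : {mpoly K[N.+1]}).
    rewrite big_seq [RHS]big_seq; apply: eq_bigr => mm mms.
    by rewrite (big_pred1 (Ordinal (w_lt mm mms))).
  rewrite (exchange_big_dep predT) //=; apply: big1 => d _.
  by rewrite -scaler_suml fiber0 scale0r.
rewrite -[pol]subr0 -[X in _ - X]sum0 {1}[pol]mpolyE -sumrB; apply: ideal_generated_sum => mm mms.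
rewrite -scalerBr -mul_mpolyC; apply: ideal_generatedM; apply: same.
by rewrite -!/(w _) w_rep.
Qed.

End Toric.

(** * Minors of the two-row matrix and the ideal they generate *)

Lemma det2E (R : comNzRingType) (M : 'M[R]_2) : \det M = M 0 0 * M 1 1 - M 0 1 * M 1 0.
Proof.
rewrite (expand_det_row _ 0) big_ord_recl big_ord1 /cofactor !det_mx11 !mxE /= .
rewrite expr0 expr1 mul1r mulN1r mulrN.
by congr (_ * M _ _ - M _ _ * M _ _); apply/val_inj.
Qed.

Lemma minor2_mem (R : comNzRingType) n (M : 'M[R]_(2, n)) (a b : 'I_n) : (a < b)%N ->
  minor2 M (M 0 a * M 1 b - M 0 b * M 1 a).
Proof.
move=> ab; exists id, (fun x : 'I_2 => if x == 0 then a else b); split => //.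
  move=> x y; case: (eqVneq x 0) => [->|x0]; case: (eqVneq y 0) => [->|y0] //=.
  move: x y x0 y0 => [[|[|x]] ltx] [[|[|y]] lty] //.
by rewrite det2E !mxE.
Qed.

Lemma minor2P (R : comNzRingType) n (M : 'M[R]_(2, n)) x : minor2 M x ->
  exists a b : 'I_n, (a < b)%N /\ x = M 0 a * M 1 b - M 0 b * M 1 a.
Proof.
move=> [f [g [hf hg ->]]]; exists (g 0), (g 1); split; first exact: hg.
have := hf 0 1 isT; rewrite det2E !mxE.
have [f0 f1] := (ltn_ord (f 0), ltn_ord (f 1)) => lt.
have -> : f 0 = 0 by apply/val_inj => /=; lia.
by have -> : f 1 = 1 by apply/val_inj => /=; lia.
Qed.

Section Matrix.
Variables (K : fieldType) (i j k : nat) (c c'' : nat -> nat).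
Local Notation N := (i + j + k)%N.
Hypothesis j_gt0 : (0 < j)%N.

Definition scroll : 'M[{mpoly K[N.+1]}]_(2, i.+1 + j.-1 + k.+1) :=
  row_mx (row_mx (Mplus K i j k c) (Mzero K i j k)) (Mminus K i j k c'').

Lemma varXE s d : ('X_(inord s) : {mpoly K[N.+1]}) ^+ d = 'X_[U_(inord s) *+ d].
Proof. by rewrite mpolyXn. Qed.

(** The three blocks fit one cyclic pattern: since [j > 0] there are [N + 1] columns, each leading
    from [Y_s] to its successor. *)
Lemma scrollE (s : 'I_(i.+1 + j.-1 + k.+1)) :
  scroll 0 s = 'X_[top_mnm N (topexp i c) s] /\
  scroll 1 s = 'X_[bot_mnm N (botexp i j k c'') s].
Proof.
rewrite /top_mnm /bot_mnm -!varXE /cyc_next /topexp /botexp /scroll.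
have [s1 -> | s3 ->] := split_ordP s.
  rewrite !row_mxEl; have [s2 -> | s3 ->] := split_ordP s1.
    rewrite !row_mxEl !mxE /= /varX /varX'; have s2i := ltn_ord s2.
    have -> : (s2 <= i)%N by lia.
    have -> : (s2 < N)%N by lia.
    have -> : (s2 < i + j)%N by lia.
    split=> //; rewrite expr1; case: ltnP => // le; congr 'X_(inord _); lia.
  rewrite !row_mxEr !mxE /= /varX'; have s3j := ltn_ord s3.
  have -> : (i.+1 + s3 <= i)%N = false by lia.
  have -> : (i.+1 + s3 < N)%N by lia.
  have -> : (i.+1 + s3 < i + j)%N by lia.
  by rewrite !expr1; split; congr 'X_(inord _); lia.
rewrite !row_mxEr !mxE /= /varX /varX' /varX''; have s3k := ltn_ord s3.
have -> : (i.+1 + j.-1 + s3 <= i)%N = false by lia.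
have -> : (i.+1 + j.-1 + s3 < N)%N = (s3 < k)%N by lia.
have -> : (i.+1 + j.-1 + s3 < i + j)%N = false by lia.
split; first by rewrite expr1; case: eqP => [->|ne]; congr 'X_(inord _); lia.
case: ltnP => [lt|le //]; have -> : (i.+1 + j.-1 + s3 - (i + j) = s3)%N by lia.
by congr ('X_(inord _) ^+ _); lia.
Qed.

Variable g : nat -> nat.
Hypothesis g_gt0 : forall s, (s <= N)%N -> (0 < g s)%N.
Hypothesis c_gt0 : forall s, (s <= i)%N -> (0 < c s)%N.
Hypothesis c''_gt0 : forall s, (s <= k)%N -> (0 < c'' s)%N.
Local Notation p := (topexp i c).
Local Notation q := (botexp i j k c'').
Variable alpha : int.
Hypothesis balanced : forall s, (s <= N)%N ->
  (q s * g (cyc_next N s))%N%:Z = (p s * g s)%N%:Z + alpha.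
Hypothesis unique : forall E E', standard N p q E -> standard N p q E' ->
  (\sum_(s < N.+1) E s * g s = \sum_(s < N.+1) E' s * g s)%N ->
  forall s, (s <= N)%N -> E s = E' s.

Lemma balanced_minor a b : (a < b <= N)%N ->
  (p a * g a + q b * g (cyc_next N b) = p b * g b + q a * g (cyc_next N a))%N.
Proof. by move=> ab; have := @balanced a; have := @balanced b; lia. Qed.

Lemma weight_columns a b : (a <= N)%N -> (b <= N)%N ->
  mnm_weight g (top_mnm N p a + bot_mnm N q b) = (p a * g a + q b * g (cyc_next N b))%N.
Proof. by move=> aN bN; rewrite mnm_weightD !mnm_weightU ?cyc_next_le. Qed.

(** Balanced columns make the minors homogeneous. Conversely, monomials of equal degree reduce to
    standard ones of that degree, which coincide by [unique]. *)
Lemma scroll_ideal (pol : {mpoly K[N.+1]}) :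
  toric_map g pol = 0 <-> I2 scroll pol.
Proof.
split=> [|].
  apply: toric_ideal => m1 m2 eqw.
  have p_gt0 s : (s <= N)%N -> (0 < p s)%N.
    by move=> sN; rewrite /topexp; case: ifP => // si; exact: c_gt0.
  have q_gt0 s : (s <= N)%N -> (0 < q s)%N.
    by move=> sN; rewrite /botexp; do 2![case: ifP => //] => *; apply: c''_gt0; lia.
  have minors a b : (a < b <= N)%N -> I2 scroll
      ('X_[top_mnm N p a + bot_mnm N q b] - 'X_[top_mnm N p b + bot_mnm N q a]).
    move=> ab; apply: ideal_generated_mem.
    have aN : (a < i.+1 + j.-1 + k.+1)%N by lia.
    have bN : (b < i.+1 + j.-1 + k.+1)%N by lia.
    have := @minor2_mem _ _ scroll (Ordinal aN) (Ordinal bN).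
    have [-> ->] := scrollE (Ordinal aN); have [-> ->] := scrollE (Ordinal bN).
    by rewrite -!mpolyXD; apply; case/andP: ab.
  have [m1' [s1 w1 J1]] := standard_form p_gt0 q_gt0 g_gt0 balanced_minor minors m1.
  have [m2' [s2 w2 J2]] := standard_form p_gt0 q_gt0 g_gt0 balanced_minor minors m2.
  have eqm : m1' = m2'.
    have wE (mm : 'X_{1..N.+1}) : mnm_weight g mm = (\sum_(s < N.+1) mnm_exp mm s * g s)%N.
      by apply: eq_bigr => s _; rewrite /mnm_exp inord_val.
    apply/mnmP => s; have := @unique _ _ s1 s2; rewrite -!wE w1 w2 eqw.
    have sN : (s <= N)%N by rewrite -ltnS.
    by move=> /(_ erefl s sN); rewrite /mnm_exp inord_val.
  apply: ideal_generated_trans J1 _; rewrite eqm -opprB; exact: ideal_generatedN.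
apply: (@ideal_generated_ind _ _ (fun x => toric_map g x = 0)) => [|x y x0 y0|r x /minor2P[a [b [ab ->]]]].
- exact: mmap0.
- by rewrite /toric_map mmapD -!/(toric_map _ _) x0 y0 addr0.
have [-> ->] := scrollE a; have [-> ->] := scrollE b.
have bN : (b <= N)%N by have := ltn_ord b; lia.
have abN : (a < b <= N)%N by rewrite ab.
have aN : (a <= N)%N by lia.
rewrite /toric_map rmorphM rmorphB -!/(toric_map _ _) -!mpolyXD /= -!/(toric_map _ _).
by rewrite !toric_mapX !weight_columns // (balanced_minor abN) subrr mulr0.
Qed.

End Matrix.

(** * From numerical semigroups to the function [C] *)

Definition gen_by (G : seq nat) (x : nat) : Prop :=
  exists c : nat -> nat, x = (\sum_(g <- G) c g * g)%N.

Lemma gen_byD G x y : gen_by G x -> gen_by G y -> gen_by G (x + y)%N.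
Proof.
move=> [c ->] [d ->]; exists (fun g => c g + d g)%N.
by rewrite -big_split; apply: eq_bigr => g _; rewrite mulnDl.
Qed.

Lemma gen_byM G x d : gen_by G x -> gen_by G (d * x)%N.
Proof.
move=> [c ->]; exists (fun g => d * c g)%N.
by rewrite big_distrr /=; apply: eq_bigr => g _; rewrite mulnA.
Qed.

Lemma gen_by_mem G g : uniq G -> g \in G -> gen_by G g.
Proof.
move=> uG gG; exists (fun x => (x == g) : nat).
rewrite (bigD1_seq g) //= eqxx mul1n big1 ?addn0 // => x /negbTE->.
by rewrite mul0n.
Qed.

Lemma gen_by_sub G x : uniq G -> gen_by G x -> (0 < x)%N ->
  exists2 g, g \in G /\ (0 < g)%N & exists2 y, x = (g + y)%N & gen_by G y.
Proof.
move=> uG [c ->] xpos.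
have [/hasP[g gG cg]|/hasPn c0] := boolP (has (fun g => 0 < c g * g)%N G); last first.
  by rewrite big_seq big1 // in xpos => g /c0; rewrite lt0n negbK => /eqP.
have [c_gt0 g_gt0] : (0 < c g)%N /\ (0 < g)%N by nia.
exists g => //; exists (\sum_(x <- G) (c x - (x == g)) * x)%N; last first.
  by exists (fun x => c x - (x == g))%N.
rewrite !(bigD1_seq g gG uG) /= eqxx addnA; congr (_ + _)%N; first by nia.
by apply: eq_bigr => z /negbTE->; rewrite subn0.
Qed.

(** * The Apery set of a numerical semigroup *)

Section Semigroup.
Variables (H : {pred nat}) (a0 : nat) (alpha : int).
Hypothesis HH : numerical_semigroup H.
Hypothesis Ha0 : multiplicity_of H a0.
Hypothesis Hcop : coprimez a0%:Z alpha.

Lemma mult_gt0 : (0 < a0)%N. Proof. by case: Ha0. Qed.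

Lemma semigroupM d x : x \in H -> (d * x)%N \in H.
Proof.
case: HH => H0 HD _ xH; elim: d => [|d IH]; first by rewrite mul0n.
by rewrite mulSn HD.
Qed.

Definition in_class (r : int) : pred nat :=
  fun x => (x \in H) && (a0%:Z %| x%:Z - r * alpha)%Z.

Lemma in_class_ex r : exists x, in_class r x.
Proof.
case: HH => _ _ [gaps Hg]; have a0n := mult_gt0.
have a0z : a0%:Z != 0 by lia.
pose B := (\sum_(x <- gaps) x).+1; pose s := `|(r * alpha %% a0%:Z)%Z|%N.
have Es : s%:Z = (r * alpha %% a0%:Z)%Z by rewrite /s gez0_abs // modz_ge0.
(* [B] exceeds every gap, so this member of the class is not a gap. *)
exists (s + B * a0)%N; apply/andP; split.
  apply/negPn/negP => /Hg gx.
  have : (s + B * a0 <= \sum_(x <- gaps) x)%N by rewrite (big_rem _ gx) leq_addr.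
  by rewrite /B; nia.
rewrite PoszD PoszM addrAC rpredD ?dvdz_mull //.
by rewrite -eqz_mod_dvd Es modz_mod.
Qed.

Definition apery_elt (r : int) : nat := ex_minn (in_class_ex r).
(** For [alpha = 1] and [0 < r < a0] these are the Kunz coordinates of [H]. *)
Definition apery_coef (r : int) : int := (((apery_elt r)%:Z - r * alpha) %/ a0%:Z)%Z.
Local Notation C := apery_coef.

Lemma apery_eltE r : (apery_elt r)%:Z = r * alpha + C r * a0%:Z.
Proof.
rewrite /C /apery_elt; case: ex_minnP => x /andP[_ dvd] _.
by rewrite divzK //; ring.
Qed.

Lemma apery_elt_in r : apery_elt r \in H.
Proof. by rewrite /apery_elt; case: ex_minnP => x /andP[]. Qed.

Lemma apery_coefP (r c : int) (x : nat) :
  x%:Z = r * alpha + c * a0%:Z -> (x \in H) = (C r <= c).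
Proof.
move=> Ex; have a0n := mult_gt0; have Er := apery_eltE r; apply/idP/idP => [xH|le].
  have : (apery_elt r <= x)%N.
    rewrite /apery_elt; case: ex_minnP => y _; apply.
    by rewrite /in_class xH Ex addrC addKr dvdz_mull.
  by move: Er Ex; nia.
have -> : x = (apery_elt r + `|(c - C r)%R|%N * a0)%N by lia.
by case: HH => _ HD _; rewrite HD ?apery_elt_in ?semigroupM //; case: Ha0.
Qed.

Lemma apery_coef_ge (r c : int) (x : nat) :
  x \in H -> x%:Z = r * alpha + c * a0%:Z -> C r <= c.
Proof. by move=> xH Ex; rewrite -(apery_coefP Ex). Qed.

Lemma apery_coef0 : C 0 = 0.
Proof.
have a0n := mult_gt0; have E0 := apery_eltE 0; rewrite mul0r add0r in E0.
have le0 : C 0 <= 0.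
  by apply: (@apery_coef_ge _ _ 0%N); [case: HH|rewrite !mul0r].
apply/eqP; rewrite eq_le le0 -(pmulr_lge0 (C 0) (_ : 0 < a0%:Z)) -?E0 //; lia.
Qed.

Lemma apery_coef_sub (r s : int) : C (r + s) <= C r + C s.
Proof.
apply: (@apery_coef_ge _ _ (apery_elt r + apery_elt s)%N).
  by case: HH => _ HD _; rewrite HD ?apery_elt_in.
by rewrite PoszD !apery_eltE; ring.
Qed.

Lemma apery_coef_perM (r t : int) : C (r + t * a0%:Z) = C r - t * alpha.
Proof.
apply/eqP; rewrite eq_le; apply/andP; split.
  by apply: (apery_coef_ge (apery_elt_in r)); rewrite apery_eltE; ring.
rewrite lerBlDr; apply: (apery_coef_ge (apery_elt_in (r + t * a0%:Z))).
by rewrite apery_eltE; ring.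
Qed.

Lemma apery_coef_per (r : int) : C (r + a0%:Z) = C r - alpha.
Proof. by have := apery_coef_perM r 1; rewrite !mul1r. Qed.

Lemma apery_elt_gt0 r : ~~ (a0%:Z %| r)%Z -> (0 < apery_elt r)%N.
Proof.
rewrite lt0n; apply: contra => /eqP E0; have := apery_eltE r; rewrite E0 => E.
rewrite -(Gauss_dvdzl _ Hcop); apply/dvdzP; exists (- C r); lia.
Qed.

Lemma vres_decomp (x : int) : exists c : int, x = (vres a0 alpha x)%:Z * alpha + c * a0%:Z.
Proof.
have [_ /eqP] := vresP x mult_gt0 Hcop; rewrite eqz_mod_dvd => /dvdzP[c Ec].
by exists c; rewrite -Ec; ring.
Qed.

Lemma vresE (v : nat) (c : int) : (v < a0)%N -> vres a0 alpha (v%:Z * alpha + c * a0%:Z) = v.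
Proof.
by move=> va; apply: vres_uniq => //; rewrite addrC modzMDl.
Qed.

Lemma vresN (x : int) : (0 < vres a0 alpha x)%N ->
  vres a0 (- alpha) x = (a0 - vres a0 alpha x)%N.
Proof.
move=> v0; have [va _] := vresP x mult_gt0 Hcop; have [c Ec] := vres_decomp x.
apply: vres_uniq; [by rewrite coprimezN|lia|].
apply/eqP; rewrite eqz_mod_dvd; apply/dvdzP; exists (c + alpha).
by rewrite {1}Ec; lia.
Qed.

(** * Pseudo-Frobenius numbers as maximal residues *)

Section PseudoFrobenius.
Variables (N m : nat) (h e : int).
Hypothesis HPF : forall p : int, PF H p <->
  exists l : nat, (1 <= l <= N)%N /\ p = h + l%:Z * alpha.
Hypothesis m_lt : (m < a0)%N.
Hypothesis hE : h = m%:Z * alpha + (e - 1) * a0%:Z.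

Lemma pf_spec (l : nat) : (1 <= l <= N)%N -> exists q : nat,
  [/\ q%:Z = (m%:Z + l%:Z) * alpha + (e - 1) * a0%:Z, q \notin H &
    forall x, x \in H -> (0 < x)%N -> (q + x)%N \in H].
Proof.
move=> ll; have [_ /(_ _)[]] := HPF (h + l%:Z * alpha); first by exists l.
by move=> q Eq [qH qx]; exists q; split=> //; rewrite -Eq hE; ring.
Qed.

(** The pseudo-Frobenius number with coefficient [e - 1] is a gap, and adding [a0] puts it in [H],
    so the threshold is exactly [e]. *)
Lemma pf_coef (l : nat) : (1 <= l <= N)%N -> C (m%:Z + l%:Z) = e.
Proof.
move=> /pf_spec[q [Eq qH qx]]; apply/eqP; rewrite eq_le; apply/andP; split.
  have [aH a_gt0 _] := Ha0; apply: (apery_coef_ge (qx _ aH a_gt0)).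
  by rewrite PoszD Eq; ring.
by move: qH; rewrite (apery_coefP Eq); lia.
Qed.

Lemma pf_ndvd (l : nat) : (1 <= l <= N)%N -> ~~ (a0%:Z %| m%:Z + l%:Z)%Z.
Proof.
move=> /pf_spec[q [Eq qH _]]; apply: contra qH => /dvdzP[t Et].
have a_gt0 := mult_gt0; have [aH _ _] := Ha0.
have Eq' : q%:Z = (t * alpha + (e - 1)) * a0%:Z by rewrite Eq Et; ring.
have -> : q = (`|(t * alpha + (e - 1))%R|%N * a0)%N by nia.
exact: semigroupM.
Qed.

(** Otherwise some [m + l] equals [a0], and a nonnegative multiple of [a0] would be a gap. *)
Lemma pf_range : (m + N < a0)%N.
Proof.
rewrite ltnNge; apply/negP => le; have ll : (1 <= a0 - m <= N)%N by lia.
have := pf_ndvd ll; have -> : m%:Z + (a0 - m)%N%:Z = a0%:Z by lia.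
by rewrite dvdzz.
Qed.

Lemma pf_max (l : nat) (r : int) : (1 <= l <= N)%N -> ~~ (a0%:Z %| r)%Z ->
  C (m%:Z + l%:Z + r) < e + C r.
Proof.
move=> ll nr; have [q [Eq _ qx]] := pf_spec ll.
have xH := apery_elt_in r; have x0 := apery_elt_gt0 nr.
have : C (m%:Z + l%:Z + r) <= e - 1 + C r.
  by apply: (apery_coef_ge (qx _ xH x0)); rewrite PoszD Eq apery_eltE; ring.
lia.
Qed.

Lemma gap_bound : exists B : nat, forall x, x \notin H -> (x < B)%N.
Proof.
have [_ _ [gaps Hg]] := HH; exists (\sum_(x <- gaps) x).+1 => x /Hg gx.
by rewrite ltnS (big_rem _ gx) leq_addr.
Qed.

(** Let [w] be the Apery element of [r]. Either [w - a0] is pseudo-Frobenius, or [w - a0 + x] is a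
    gap for some positive [x] in [H], and then [w + x] is a larger Apery element. Gaps are bounded,
    so the climb ends. *)
Lemma pf_below (r : int) : ~~ (a0%:Z %| r)%Z ->
  exists2 l : nat, (1 <= l <= N)%N & C r + C (m%:Z + l%:Z - r) = e.
Proof.
have [B HB] := gap_bound; have a_gt0 := mult_gt0; have [aH _ a_min] := Ha0.
have [_ HD _] := HH.
have [n] := ubnP (B + a0 - apery_elt r)%N; elim: n r => // n IH r ltn nr.
have xH := apery_elt_in r; have x0 := apery_elt_gt0 nr.
have Er := apery_eltE r; have xa := a_min _ xH x0.
pose q := (apery_elt r - a0)%N.
have Eq : q%:Z = r * alpha + (C r - 1) * a0%:Z by rewrite /q -subzn // Er; ring.
have qH : q \notin H by rewrite (apery_coefP Eq); lia.
have qB := HB q qH.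
(* Since [q + x] has to be a gap, a search below [B] is exhaustive. *)
have [/hasP[x _ /and3P[xH' x_gt0 qx]]|/hasPn noPF] :=
    boolP (has (fun x => [&& x \in H, 0 < x & (q + x)%N \notin H]%N) (iota 0 B)).
  have [c Ec] := vres_decomp x%:Z; set s := (vres a0 alpha x)%:Z in Ec.
  have Eqx : (q + x)%N%:Z = (r + s) * alpha + (C r - 1 + c) * a0%:Z.
    by rewrite PoszD Eq Ec; ring.
  have cs := apery_coef_ge xH' Ec; have sub := apery_coef_sub r s.
  move: qx; rewrite (apery_coefP Eqx) => lt.
  have Ers : C (r + s) = C r + C s by lia.
  have Ecs : c = C s by lia.
  have Ex : (apery_elt (r + s))%:Z = (apery_elt r)%:Z + x%:Z.
    by rewrite !apery_eltE Ers Ec Ecs; ring.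
  (* A residue divisible by [a0] has Apery element 0, unlike this positive sum. *)
  have nrs : ~~ (a0%:Z %| r + s)%Z.
    apply/negP => /dvdzP[t Et]; have := apery_coef_perM 0 t.
    rewrite add0r -Et apery_coef0 => C0; have := apery_eltE (r + s).
    by rewrite C0 Et; lia.
  have [|l ll El] := IH (r + s) _ nrs; first by lia.
  exists l => //; have := apery_coef_sub s (m%:Z + l%:Z - (r + s)).
  have := apery_coef_sub r (m%:Z + l%:Z - r); rewrite addrC subrK (pf_coef ll).
  have -> : s + (m%:Z + l%:Z - (r + s)) = m%:Z + l%:Z - r by ring.
  lia.
have [|l [ll El]] := (HPF q%:Z).1.
  exists q => //; split=> // x x_H x_gt0; apply/negPn/negP => qx.
  have xB : (x < B)%N by have := HB _ qx; lia.
  by have := noPF x; rewrite mem_iota x_H x_gt0 qx /= => /(_ xB).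
exists l => //.
have : (a0%:Z %| r - (m%:Z + l%:Z))%Z.
  rewrite -(Gauss_dvdzl _ Hcop); apply/dvdzP; exists (e - C r).
  by move: El; rewrite Eq hE; lia.
move=> /dvdzP[t Et]; have -> : r = m%:Z + l%:Z + t * a0%:Z by lia.
have -> : m%:Z + l%:Z - (m%:Z + l%:Z + t * a0%:Z) = 0 + (- t) * a0%:Z by ring.
by rewrite !apery_coef_perM apery_coef0 (pf_coef ll); ring.
Qed.

End PseudoFrobenius.

End Semigroup.

(** * A single numbering of the three families of generators *)

Section GenList.
Variables (i j k : nat) (a a' a'' : nat -> nat).

Definition gen_nth (s : nat) : nat := nth 0%N (gen_list i j k a a' a'') s.

Lemma size_gen_list : size (gen_list i j k a a' a'') = (i + j + k).+1.
Proof. by rewrite /gen_list !size_cat !size_map !size_iota; lia. Qed.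

Lemma gen_nth_lo s : (s <= i)%N -> gen_nth s = a s.
Proof.
move=> si; rewrite /gen_nth /gen_list nth_cat size_map size_iota ltnS si.
by rewrite (nth_map 0%N) ?size_iota // nth_iota.
Qed.

Lemma gen_nth_mid s : (1 <= s <= j)%N -> gen_nth (i + s) = a' s.
Proof.
move=> sj; rewrite /gen_nth /gen_list nth_cat size_map size_iota.
have -> : (i + s < i.+1)%N = false by lia.
rewrite nth_cat size_map size_iota; have -> : (i + s - i.+1 = s.-1)%N by lia.
have sj' : (s.-1 < j)%N by lia.
by rewrite sj' (nth_map 0%N) ?size_iota // nth_iota //; congr a'; lia.
Qed.

Lemma gen_nth_hi s : (1 <= s <= k)%N -> gen_nth (i + j + s) = a'' s.
Proof.
move=> sk; rewrite /gen_nth /gen_list nth_cat size_map size_iota.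
have -> : (i + j + s < i.+1)%N = false by lia.
rewrite nth_cat size_map size_iota; have -> : (i + j + s - i.+1 = j + s.-1)%N by lia.
have -> : (j + s.-1 < j)%N = false by lia.
rewrite addKn (nth_map 0%N) ?size_iota; last lia.
by rewrite nth_iota; [congr a''; lia|lia].
Qed.

Lemma gen_listP x : x \in gen_list i j k a a' a'' ->
  [\/ x = a 0%N, exists2 s, (1 <= s <= i)%N & x = a s,
      exists2 s, (1 <= s <= j)%N & x = a' s | exists2 s, (1 <= s <= k)%N & x = a'' s].
Proof.
rewrite /gen_list !mem_cat => /or3P[] /mapP[s]; rewrite mem_iota => sij ->.
- case: s sij => [|s] sij; [by constructor 1|constructor 2; exists s.+1 => //; lia].
- by constructor 3; exists s => //; lia.
- by constructor 4; exists s => //; lia.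
Qed.

End GenList.

Lemma size_generators H alpha a0 G i j k a a' a'' :
  minimal_generators G H -> labelling H alpha a0 G i j k a a' a'' ->
  size G = (i + j + k).+1.
Proof.
move=> [uG _ _] [_ _ _ _ [eqG Hs]]; rewrite -(size_gen_list i j k a a' a'').
apply: perm_size; apply: uniq_perm => //.
by apply: map_uniq (sorted_uniq ltn_trans ltnn Hs).
Qed.

(** * The labelled generators and the exponents of the matrix *)

Section Generators.
Variables (H : {pred nat}) (a0 : nat) (h alpha : int) (G : seq nat) (i j k : nat).
Variables (a a' a'' : nat -> nat) (m : nat) (e : int).
Hypothesis HH : numerical_semigroup H.
Hypothesis HG : minimal_generators G H.
Hypothesis Ha0 : multiplicity_of H a0.
Hypothesis Hcop : coprimez a0%:Z alpha.
Local Notation N := (i + j + k)%N.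
Hypothesis N_ge2 : (2 <= N)%N.
Hypothesis HPF : forall p : int, PF H p <->
  exists l : nat, (1 <= l <= N)%N /\ p = h + l%:Z * alpha.
Hypothesis Hlab : labelling H alpha a0 G i j k a a' a''.
Hypothesis m_lt : (m < a0)%N.
Hypothesis hE : h = m%:Z * alpha + (e - 1) * a0%:Z.
Hypothesis Hv : (vres a0 alpha (a i)%:Z
             + (if k == 0%N then 0%N else vres a0 (- alpha) (a'' 1%N)%:Z) < N)%N.

Local Notation C := (apery_coef HH Ha0 Hcop).
Local Notation v_ x := (vres a0 alpha (Posz x)).
Local Notation gen := (gen_nth i j k a a' a'').

Let range : (m + N < a0)%N := pf_range HH Ha0 Hcop HPF m_lt hE.

Lemma PFplusP q : PFplus H a0 q <->
  exists2 l : nat, (1 <= l <= N)%N & q = (m%:Z + l%:Z) * alpha + e * a0%:Z.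
Proof.
split=> [[p /HPF[l [ll ->]] ->]|[l ll ->]].
  by exists l => //; rewrite hE; ring.
exists (h + l%:Z * alpha); first by apply/HPF; exists l.
by rewrite hE; ring.
Qed.

Lemma vres_PFplus (l : nat) : (1 <= l <= N)%N ->
  vres a0 alpha ((m%:Z + l%:Z) * alpha + e * a0%:Z) = (m + l)%N.
Proof. by move=> ll; rewrite -PoszD vresE //; lia. Qed.

Lemma label_mono s t : (s < t)%N -> (t <= N)%N -> (v_ (gen s) < v_ (gen t))%N.
Proof.
move=> st tN; have [_ _ _ _ [_ Hs]] := Hlab.
have := sorted_ltn_nth ltn_trans 0%N Hs; rewrite /gen_nth.
move=> /(_ s t); rewrite !inE !size_map size_gen_list => /(_ _ _ st).
rewrite !(nth_map 0%N) ?size_gen_list; try lia.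
Qed.

Lemma label_a0 : a 0%N = a0. Proof. by case: Hlab. Qed.

Lemma vres_a0 : v_ a0 = 0%N.
Proof.
have := @vresE a0 alpha Hcop 0 1; rewrite mul0r add0r mul1r; apply.
exact: (mult_gt0 Ha0).
Qed.

Lemma label_lo s : (1 <= s <= i)%N -> (1 <= v_ (a s))%N /\ (v_ (a s) <= m)%N.
Proof.
move=> si; split.
  have := @label_mono 0 s; rewrite !gen_nth_lo ?label_a0 ?vres_a0; lia.
have [_ Ha _ _ _] := Hlab.
have /Ha[_ lt] : a s \in [seq a s | s <- iota 1 i] by apply/map_f; rewrite mem_iota; lia.
have l1 : (1 <= 1 <= N)%N by lia.
have := lt ((m%:Z + 1%:Z) * alpha + e * a0%:Z); rewrite vres_PFplus //.
have PF1 : PFplus H a0 ((m%:Z + 1%:Z) * alpha + e * a0%:Z) by apply/PFplusP; exists 1%N.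
by move=> /(_ PF1); lia.
Qed.

Lemma label_hi s : (1 <= s <= k)%N -> (m + N < v_ (a'' s))%N /\ (v_ (a'' s) < a0)%N.
Proof.
move=> sk; split; last by have [] := vresP (a'' s)%:Z (mult_gt0 Ha0) Hcop.
have [_ _ _ Ha _] := Hlab.
have /Ha[_ lt] : a'' s \in [seq a'' s | s <- iota 1 k].
  by apply/map_f; rewrite mem_iota; lia.
have lN : (1 <= N <= N)%N by lia.
have := lt ((m%:Z + N%:Z) * alpha + e * a0%:Z); rewrite vres_PFplus //.
by apply; apply/PFplusP; exists N.
Qed.

Definition mid_index (s : nat) : nat := (v_ (a' s) - m)%N.

Lemma label_mid s : (1 <= s <= j)%N -> (1 <= mid_index s <= N)%N /\
  (a' s)%:Z = (m%:Z + (mid_index s)%:Z) * alpha + e * a0%:Z.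
Proof.
move=> sj; have [_ _ Ha _ _] := Hlab.
have /Ha[_ /PFplusP[l ll El]] : a' s \in [seq a' s | s <- iota 1 j].
  by apply/map_f; rewrite mem_iota; lia.
by rewrite /mid_index El vres_PFplus // addKn.
Qed.

Lemma gen_in s : (s <= N)%N -> gen s \in G.
Proof.
by move=> sN; have [_ _ _ _ [-> _]] := Hlab; rewrite mem_nth // size_gen_list.
Qed.

Lemma gen_gt0 g : g \in G -> (0 < g)%N.
Proof.
have [_ _ _ _ [-> _]] := Hlab => /(nthP 0%N)[s]; rewrite size_gen_list ltnS => sN <-.
rewrite lt0n -/(gen s); apply/negP => /eqP E.
have v0 : v_ 0%N = 0%N.
  have := @vresE a0 alpha Hcop 0 0; rewrite !mul0r addr0; apply; exact: (mult_gt0 Ha0).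
case: s sN E => [|s] sN E.
  by move: E; rewrite gen_nth_lo // label_a0; have := mult_gt0 Ha0; lia.
by have := label_mono (ltn0Sn s) sN; rewrite E v0.
Qed.

(** If [g] were not least in its class, [g - a0] would lie in [H], and [g] could be generated by
    [a0] and other generators, against minimality. *)
Lemma gen_apery g (r c : int) : g \in G -> g != a0 ->
  g%:Z = r * alpha + c * a0%:Z -> C r = c.
Proof.
move=> gG ga Eg; have [uG HGen Hmin] := HG; have [_ HD _] := HH.
have G_by x : x \in H <-> gen_by G x by apply: HGen.
have gH : g \in H by apply/G_by; apply: gen_by_mem.
have le := apery_coef_ge HH Ha0 Hcop gH Eg.
apply/eqP; rewrite eq_le le leNgt; apply/negP => lt.
have a0_gt0 := mult_gt0 Ha0; have g_gt0 := gen_gt0 gG.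
have aG : a0 \in G by rewrite -label_a0 -(@gen_nth_lo i j k a a' a'') // gen_in.
pose G' := rem g G; have uG' : uniq G' by apply: rem_uniq.
have memG' x : (x \in G') = (x != g) && (x \in G) by rewrite mem_rem_uniq.
have aG' : a0 \in G' by rewrite memG' eq_sym ga.
have Egx : (apery_elt HH Ha0 Hcop r)%:Z = r * alpha + C r * a0%:Z by rewrite apery_eltE.
have [x xH Ex] : exists2 x, x \in H & g = (a0 + x)%N.
  exists (apery_elt HH Ha0 Hcop r + `|(c - 1 - C r)%R|%N * a0)%N.
    by rewrite HD ?apery_elt_in ?semigroupM //; case: Ha0.
  by apply/eqP; rewrite -eqz_nat PoszD PoszD PoszM Egx Eg; apply/eqP; nia.
have perm_G : perm_eq G (g :: G') by apply: perm_to_rem.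
have gen_x : gen_by G' x.
  have /G_by[d Ed] := xH; exists d; move: Ed; rewrite (perm_big _ perm_G) big_cons => Ed.
  (* An expression of [x] cannot involve [g], because [x < g]. *)
  have [d0|d_gt0] := posnP (d g); first by rewrite {1}Ed d0.
  have : (g <= x)%N by rewrite Ed (leq_trans _ (leq_addr _ _)) ?leq_pmull.
  by lia.
have gen_g : gen_by G' g by rewrite Ex; apply: gen_byD => //; apply: gen_by_mem.
have HGen' : generates G' H.
  move=> y; rewrite -/(gen_by G' y); split=> [/G_by[d]|[d Ed]].
    rewrite (perm_big _ perm_G) big_cons => ->; apply: gen_byD; first exact: gen_byM.
    by exists d.
  apply/G_by; exists (fun z => if z == g then 0%N else d z).
  rewrite (perm_big _ perm_G) big_cons /= eqxx mul0n add0n Ed.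
  rewrite big_seq [RHS]big_seq; apply: eq_bigr => z; rewrite memG' => /andP[/negbTE-> _].
  by [].
have sub : {subset G' <= G} by move=> z; rewrite memG' => /andP[].
by have := Hmin G' sub HGen' g gG; rewrite memG' eqxx.
Qed.

Definition lo_index (s : nat) : nat := v_ (a s).
(** These are values of [v_(- alpha)], listed backwards so that they increase; [t = k] corresponds
    to [a'' 1]. *)
Definition hi_index (t : nat) : nat := (a0 - v_ (a'' (k.+1 - t)%N))%N.

Lemma lo_genE s : (1 <= s <= i)%N ->
  (a s)%:Z = (lo_index s)%:Z * alpha + C (lo_index s)%:Z * a0%:Z.
Proof.
move=> si; have [c Ec] := vres_decomp Ha0 Hcop (a s)%:Z.
rewrite {1}Ec; congr (_ + _ * _); apply/esym/(gen_apery _ _ Ec).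
  by rewrite -(@gen_nth_lo i j k a a' a'') ?gen_in; lia.
by apply/eqP => E; have := label_lo si; rewrite E vres_a0; lia.
Qed.

Lemma hi_genE t : (1 <= t <= k)%N ->
  (a'' (k.+1 - t)%N)%:Z = - (hi_index t)%:Z * alpha + C (- (hi_index t)%:Z) * a0%:Z.
Proof.
move=> tk; have tk' : (1 <= k.+1 - t <= k)%N by lia.
have [c Ec] := vres_decomp Ha0 Hcop (a'' (k.+1 - t)%N)%:Z.
have [lt1 lt2] := label_hi tk'.
have Ec' : (a'' (k.+1 - t)%N)%:Z = - (hi_index t)%:Z * alpha + (c + alpha) * a0%:Z.
  by rewrite {1}Ec /hi_index -subzn ?(ltnW lt2) //; ring.
rewrite {1}Ec'; congr (_ + _ * _); apply/esym/(gen_apery _ _ Ec').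
  by rewrite -(@gen_nth_hi i j k a a' a'') ?gen_in; lia.
by apply/eqP => E; move: lt1; rewrite E vres_a0.
Qed.

Definition gap_width : nat := (a0 - 1 - m - N)%N.

Lemma semigroup_profile :
  apery_profile C alpha m gap_width N e i k lo_index hi_index
    (fun l => exists2 s, (1 <= s <= j)%N & l = mid_index s).
Proof.
have Ea : (m + gap_width + N + 1 = a0)%N by rewrite /gap_width; have := range; lia.
have lo_inc s t : (1 <= s)%N -> (s < t)%N -> (t <= i)%N -> (lo_index s < lo_index t)%N.
  by move=> s1 st ti; have := @label_mono s t st; rewrite !gen_nth_lo; try lia; apply; lia.
have hi_inc s t : (1 <= s)%N -> (s < t)%N -> (t <= k)%N -> (hi_index s < hi_index t)%N.
  move=> s1 st tk; have := @label_mono (i + j + (k.+1 - t)) (i + j + (k.+1 - s)).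
  have lts := @label_hi (k.+1 - s); have ltt := @label_hi (k.+1 - t).
  by rewrite !gen_nth_hi /hi_index; lia.
(* The two indices bounded by [Hv] are the largest on their sides, so the bound extends to all
   pairs. *)
have lo_le s : (1 <= s <= i)%N -> (lo_index s <= v_ (a i))%N.
  by move=> si; have [->//|ne] := eqVneq s i; apply/ltnW/lo_inc; lia.
have hi_le t : (1 <= t <= k)%N -> (hi_index t <= hi_index k)%N.
  by move=> tk; have [->//|ne] := eqVneq t k; apply/ltnW/hi_inc; lia.
have Hv_lo : (v_ (a i) < N)%N by apply: leq_ltn_trans Hv; apply: leq_addr.
have Hv_hi : (0 < k)%N -> (v_ (a i) + hi_index k < N)%N.
  move=> k0; move: Hv; have -> : (k == 0%N) = false by lia.
  rewrite (vresN Ha0 Hcop); last by have [] := @label_hi 1; lia.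
  by rewrite /hi_index subSnn.
split; rewrite ?Ea.
- exact: apery_coef0.
- exact: apery_coef_sub.
- exact: apery_coef_per.
- exact: pf_coef.
- exact: pf_max.
- exact: pf_below.
- move=> r nr; rewrite -apery_eltE; exact: apery_elt_gt0.
- move=> r nr; have w_gt0 := apery_elt_gt0 HH Ha0 Hcop nr.
  have [uG HGen _] := HG.
  have /HGen/(gen_by_sub uG)/(_ w_gt0)[g [gG _] [y Ew y_by]] := apery_elt_in HH Ha0 Hcop r.
  have yH : y \in H by apply/HGen.
  have Er := apery_eltE HH Ha0 Hcop r; rewrite Ew PoszD in Er.
  have split_by (rho : int) : g%:Z = rho * alpha + C rho * a0%:Z -> C r = C rho + C (r - rho).
    move=> Eg; apply/eqP; rewrite eq_le; apply/andP; split.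
      by have := apery_coef_sub HH Ha0 Hcop rho (r - rho); rewrite addrC subrK.
    rewrite -lerBrDl; apply: (apery_coef_ge HH Ha0 Hcop yH).
    by rewrite -[y%:Z](addKr g%:Z) Er Eg; ring.
  have [_ _ _ _ [eqG _]] := Hlab; rewrite eqG in gG.
  have [g0|[s si gs]|[s sj gs]|[s sk gs]] := gen_listP gG.
  (* An Apery element minus [a0] is not in [H], so the generator split off cannot be [a0]. *)
  + have Ey : y%:Z = r * alpha + (C r - 1) * a0%:Z.
      by rewrite -[y%:Z](addKr g%:Z) Er g0 label_a0; ring.
    by have := apery_coef_ge HH Ha0 Hcop yH Ey; lia.
  + exists (lo_index s)%:Z; first by apply: split_by; rewrite gs lo_genE.
    by constructor 1; exists s.
  + have [ll El] := label_mid sj; exists (m%:Z + (mid_index s)%:Z).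
      apply: split_by; rewrite gs {1}El; congr (_ + _ * _).
      by rewrite (pf_coef HH Ha0 Hcop HPF m_lt hE ll).
    by constructor 3; exists (mid_index s) => //; split=> //; exists s.
  + have sk' : (1 <= k.+1 - s <= k)%N by lia.
    exists (- (hi_index (k.+1 - s))%:Z).
      apply: split_by; rewrite -hi_genE // gs; congr (Posz (a'' _)); lia.
    by constructor 2; exists (k.+1 - s)%N.
- exact: lo_inc.
- exact: hi_inc.
- exact: label_lo.
- move=> s sk; have [] := @label_hi (k.+1 - s); first lia.
  by rewrite /hi_index /gap_width; lia.
- by move=> s si; apply: leq_ltn_trans (lo_le s si) Hv_lo.
- by move=> t tk; have := hi_le t tk; have := Hv_hi; lia.
- by move=> s t si tk; have := lo_le s si; have := hi_le t tk; have := Hv_hi; lia.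
- by [].
Qed.

Local Notation v := lo_index.
Local Notation u := hi_index.
Local Notation l' := mid_index.
Local Notation Q := gap_width.

Let P := semigroup_profile.

Lemma gap_widthE : (m + Q + N + 1 = a0)%N.
Proof.
have := range; rewrite /gap_width; lia.
Qed.

Lemma scroll_mid_inc s t : (1 <= s)%N -> (s < t)%N -> (t <= j)%N -> (l' s < l' t)%N.
Proof.
move=> s1 st tj; have := @label_mono (i + s) (i + t).
rewrite !gen_nth_mid; try lia.
have [] := @label_mid s; first lia.
rewrite /mid_index; lia.
Qed.

Let midE l (Hl : exists2 s, (1 <= s <= j)%N & l = l' s) := Hl.

Lemma scroll_j_gt0 : (0 < j)%N.
Proof. exact: ap_j_gt0 P. Qed.

(** The chain relations for residues and for values of [C] have the same factors; together they give
    every column the same degree difference [alpha]. *)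
Lemma scroll_exponents : exists c c'' : nat -> nat,
  [/\ forall s, (s <= i)%N -> (0 < c s)%N, forall s, (s <= k)%N -> (0 < c'' s)%N,
      [/\ (0 < i)%N -> v 1%N = 1%N,
        forall s, (1 <= s < i)%N -> v s.+1 = (c s * v s).+1
      & if i is 0 then m = 0%N else (m + i = c i * v i)%N],
      [/\ (0 < k)%N -> u 1%N = 1%N,
        forall s, (1 <= s < k)%N -> u s.+1 = (c'' (k.+1 - s)%N * u s).+1
      & if k is 0 then Q = 0%N else (Q + k = c'' 1%N * u k)%N]
    & forall s, (s <= N)%N -> (botexp i j k c'' s * gen (cyc_next N s))%N%:Z
                       = (topexp i c s * gen s)%N%:Z + alpha].
Proof.
have j0 := scroll_j_gt0; have Ea := gap_widthE.
have Ce l (ll : (1 <= l <= N)%N) : C (m%:Z + l%:Z) = e.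
  exact: (pf_coef HH Ha0 Hcop HPF m_lt hE ll).
have C1 : 1 <= C 1%N%:Z by apply: (ap_gt0 P).
have C1' : 1 <= C (- 1%N%:Z) by apply: (ap_gt0 (ap_flip P)).
have [d [d0 dl dS]] : exists d : nat -> nat, [/\ forall s, (1 <= s <= i)%N -> (0 < d s)%N,
    (0 < i)%N -> (m + i = d i * v i)%N /\ e = (d i)%:Z * C (v i)%:Z &
    forall s, (1 <= s < i)%N -> v s.+1 = (d s * v s).+1 /\
      C (v s.+1)%:Z = (d s)%:Z * C (v s)%:Z].
  have [i0|i_gt0] := posnP i; first by exists (fun=> 1%N); split=> // *; lia.
  have [d d0 [d1 d2 dS]] := ap_chain P i_gt0 (ap_top_i P midE scroll_mid_inc i_gt0).
  by exists d.
have [f [f0 fl fS]] : exists f : nat -> nat, [/\ forall s, (1 <= s <= k)%N -> (0 < f s)%N,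
    (0 < k)%N -> (Q + k = f k * u k)%N /\ e + alpha = (f k)%:Z * C (- (u k)%:Z) &
    forall s, (1 <= s < k)%N -> u s.+1 = (f s * u s).+1 /\
      C (- (u s.+1)%:Z) = (f s)%:Z * C (- (u s)%:Z)].
  have [k0|k_gt0] := posnP k; first by exists (fun=> 1%N); split=> // *; lia.
  have [f f0 [f1 f2 fS]] :=
    ap_chain (ap_flip P) k_gt0 (ap_top_k P midE scroll_mid_inc k_gt0).
  by exists f.
have v1 : (0 < i)%N -> v 1%N = 1%N.
  by move=> i_gt0; have [_] := ap_v1 P (ap_m_gt0 P i_gt0).
have u1 : (0 < k)%N -> u 1%N = 1%N.
  by move=> k_gt0; have [_] := ap_v1 (ap_flip P) (ap_m_gt0 (ap_flip P) k_gt0).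
have m0 : i = 0%N -> m = 0%N.
  by move=> i0; apply/eqP; rewrite -leqn0 leqNgt; apply/negP => /(ap_v1 P)[]; rewrite i0.
have Q0 : k = 0%N -> Q = 0%N.
  move=> k0; apply/eqP; rewrite -leqn0 leqNgt; apply/negP => /(ap_v1 (ap_flip P))[].
  by rewrite k0.
(* The generators of residues [1] and [-1] are [alpha + C 1 a0] and [- alpha + C (-1) a0], which
   dictates the powers of [X_0] in the outer columns. The remaining [c''] are the factors of the
   reflected chain in reverse order. *)
exists (fun s => if s == 0%N then `|C 1%N%:Z|%N else d s).
exists (fun t => if t == 0%N then `|C (- 1%N%:Z)|%N else f (k.+1 - t)%N); split.
- by move=> [|s] si /=; [lia|apply: d0; lia].
- by move=> [|s] si /=; [lia|apply: f0; lia].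
- split=> // [s si|].
    have -> : (s == 0%N) = false by lia.
    by have [] := dS s si.
  have [i0|i_gt0] := posnP i; first by move: (m0 i0); case: (i) i0.
  by move: i_gt0 (dl i_gt0); case: (i) => // ? _ [].
- split=> // [s sk|].
    have -> : (k.+1 - s == 0)%N = false by lia.
    have -> : (k.+1 - (k.+1 - s) = s)%N by lia.
    by have [] := fS s sk.
  have [k0|k_gt0] := posnP k; first by move: (Q0 k0); case: (k) k0.
  by have [+ _] := fl k_gt0; rewrite subSS subn0; case: (k) k_gt0.
have mid_gen s : (1 <= s <= j)%N ->
    (gen (i + s)%N)%:Z = (m%:Z + (i + s)%N%:Z) * alpha + e * a0%:Z.
  move=> sj; have [_ Es] := label_mid sj.
  by rewrite gen_nth_mid // Es (ap_mid_index P midE scroll_mid_inc sj).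
have hi_gen t : (1 <= t <= k)%N -> (gen (N.+1 - t)%N)%:Z
    = - (u t)%:Z * alpha + C (- (u t)%:Z) * a0%:Z.
  move=> tk; rewrite -hi_genE // -(@gen_nth_hi i j k a a' a''); last lia.
  by congr (Posz (gen _)); lia.
move=> s sN; rewrite /botexp /topexp /cyc_next !PoszM; cbv beta.
have [lt|ge] := ltnP s i.
  have -> : (s < i + j)%N by lia.
  have -> : (s < N)%N by lia.
  rewrite (ltnW lt) mul1r gen_nth_lo // lo_genE //.
  case: s sN lt => [|s] sN lt /=.
    by rewrite v1 // gen_nth_lo // label_a0 gez0_abs; [ring|lia].
  have [] := dS s.+1 lt => Ev Ec; rewrite gen_nth_lo ?lo_genE //; [|lia|lia].
  by rewrite Ec Ev -[_.+1]addn1 PoszD PoszM; ring.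
(* Column [i] ends at [X'_1], of residue [m + i + 1], where [m + i = d i * v i]; if [i = 0], then
   [m = 0] and [e = C 1]. *)
have [->|ne] := eqVneq s i.
  rewrite leqnn; have -> : (i < i + j)%N by lia.
  have -> : (i < N)%N by lia.
  rewrite -[i.+1]addn1 mid_gen; last lia.
  rewrite mul1r gen_nth_lo //; have [i0|i_gt0] := posnP i.
    have Ee : e = C 1%N%:Z by rewrite -(Ce 1%N) ?m0 ?add0r //; lia.
    by rewrite i0 /= m0 // label_a0 Ee gez0_abs; [ring|lia].
  have [Em Ee] := dl i_gt0; rewrite lo_genE ?i_gt0 ?leqnn //.
  have -> : m%:Z + (i + 1)%N%:Z = (d i * v i)%N%:Z + 1 by rewrite -Em; lia.
  by rewrite {1}Ee PoszM; ring.
have -> : (s <= i)%N = false by lia.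
(* Consecutive middle generators have consecutive residues and the same coefficient [e]. *)
have [lt|ge2] := ltnP s (i + j).
  have -> : (s < N)%N by lia.
  have Es : s = (i + (s - i))%N by lia.
  have Es' : s.+1 = (i + (s - i).+1)%N by lia.
  have := mid_gen (s - i).+1; rewrite -Es' => ->; last lia.
  have := mid_gen (s - i)%N; rewrite -Es => ->; last lia.
  by rewrite !mul1r -[s.+1]addn1 PoszD; ring.
have top_col : (gen s)%:Z + alpha = if s == (i + j)%N then (m%:Z + (i + j)%N%:Z + 1) * alpha
    + e * a0%:Z else (1 - (u (N.+1 - s)%N)%:Z) * alpha + C (- (u (N.+1 - s)%N)%:Z) * a0%:Z.
  case: eqP => [->|ne2]; first by rewrite mid_gen; [ring|lia].
  have {1}-> : s = (N.+1 - (N.+1 - s))%N by lia.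
  by rewrite hi_gen; [ring|lia].
rewrite mul1r {}top_col.
have [lt|ge3] := ltnP s N.
  have -> /= : ((s - (i + j)).+1 == 0)%N = false by lia.
  have -> : (k.+1 - (s - (i + j)).+1 = N - s)%N by lia.
  have -> : s.+1 = (N.+1 - (N - s))%N by lia.
  rewrite hi_gen; last lia.
  case: eqP => [->|ne2].
    have -> : (N - (i + j) = k)%N by lia.
    have [|EQ Ee] := fl _; first lia.
    have -> : e = (f k)%:Z * C (- (u k)%:Z) - alpha by rewrite -Ee; ring.
    (* The residue after that of [X'_j] is [a0 - (Q + k)], and the period [a0] is absorbed by
       replacing [e] with [e + alpha]. *)
    have -> : m%:Z + (i + j)%N%:Z + 1 = a0%:Z - (f k * u k)%N%:Z by rewrite -EQ; lia.
    by rewrite PoszM; ring.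
  have -> : (N.+1 - s = (N - s).+1)%N by lia.
  have [|Eu Ec] := fS (N - s)%N; first lia.
  by rewrite Ec Eu -[_.+1]addn1 PoszD PoszM; ring.
have Es : s = N by lia.
rewrite Es /= gen_nth_lo // label_a0 gez0_abs; last lia.
(* For [k = 0] the last column starts at [X'_j]; then [Q = 0] and [e + alpha = C (-1)]. *)
have [k0|k_gt0] := posnP k.
  have -> : (N == i + j)%N by lia.
  have -> : m%:Z + (i + j)%N%:Z + 1 = a0%:Z by have := Q0 k0; lia.
  have <- : e + alpha = C (- 1%N%:Z); last by ring.
  have := ap_top (ap_flip P) (_ : 1 <= 1 <= N)%N; rewrite Q0 // add0r => -> //; lia.
have -> : (N == i + j)%N = false by lia.
by rewrite subSnn u1 //; ring.
Qed.

Lemma gen_residue s : (s <= N)%N ->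
  exists gam : int, (gen s)%:Z = residue i j k v u m s * alpha + gam * a0%:Z.
Proof.
move=> sN; rewrite /residue.
case: eqP => [->|s0]; first by exists 1; rewrite gen_nth_lo // label_a0; ring.
case: ifP => [si|si]; first by exists (C (v s)%:Z); rewrite gen_nth_lo // lo_genE //; lia.
case: ifP => [sij|sij].
  have sj : (1 <= s - i <= j)%N by lia.
  have -> : s = (i + (s - i))%N by lia.
  exists e; rewrite gen_nth_mid //.
  have [_ ->] := label_mid sj.
  by rewrite (ap_mid_index P midE scroll_mid_inc sj) -PoszD.
have sk : (1 <= N.+1 - s <= k)%N by lia.
have := hi_genE sk.
have -> : (k.+1 - (N.+1 - s) = s - (i + j))%N by lia.
move=> E; exists (C (- (u (N.+1 - s)%N)%:Z)); rewrite -E.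
have {1}-> : s = (i + j + (s - (i + j)))%N by lia.
by rewrite gen_nth_hi //; lia.
Qed.

(** As [alpha] is invertible modulo [a0], the degree of a monomial determines its residue. *)
Lemma weight_residue (E : nat -> nat) : exists gam : int,
  (\sum_(s < N.+1) E s * gen s)%N%:Z
    = residue_sum i j k v u m E * alpha + gam * a0%:Z.
Proof.
rewrite /residue_sum big_mkord (big_morph Posz PoszD (erefl 0%:Z)).
elim/big_rec2: _ => [|s x y _ [gam ->]]; first by exists 0; ring.
have [|gs Es] := @gen_residue s; first by rewrite -ltnS.
by exists ((E s)%:Z * gs + gam); rewrite PoszM Es; ring.
Qed.

Lemma toric_map_scroll (K : fieldType) : exists c c'' : nat -> nat,
  [/\ forall s, (s <= i)%N -> (0 < c s)%N, forall s, (s <= k)%N -> (0 < c'' s)%N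
    & forall pol : {mpoly K[N.+1]}, toric_map gen pol = 0 <-> I2 (scroll K i j k c c'') pol].
Proof.
have [c [c'' [c0 c''0 [v1 vS vl] [u1 uS ul] bal]]] := scroll_exponents.
exists c, c''; split => // pol.
have g0 s : (s <= N)%N -> (0 < gen s)%N.
  by move=> sN; apply: gen_gt0; apply: gen_in.
apply: (scroll_ideal scroll_j_gt0 g0 c0 c''0 bal) => E E' sE sE' eqw.
have EE s : (1 <= s <= N)%N -> E s = E' s.
  apply: (standard_unique v1 vS vl u1 uS ul sE sE').
  rewrite gap_widthE -(Gauss_dvdzl _ Hcop) mulrBl.
  have [gam Eg] := weight_residue E; have [gam' Eg'] := weight_residue E'.
  apply/dvdzP; exists (gam' - gam); move: Eg; rewrite eqw Eg' mulrBl; lia.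
(* The other exponents agree, so equality of weights leaves only one value for the exponent of
   [Y_0]. *)
move=> s sN; case: s sN => [_|s sN]; last by apply: EE.
move: eqw; rewrite !big_ord_recl /= => /eqP.
rewrite (eq_bigr (fun s : 'I_N => E' (bump 0 s) * gen (bump 0 s))%N) => [|s _]; last first.
  by rewrite EE //; have := ltn_ord s; rewrite /bump; lia.
by rewrite eqn_add2r eqn_pmul2r ?g0 // => /eqP.
Qed.

End Generators.

Unset Implicit Arguments.

Theorem theorem3p1 (H : {pred nat}) (n a0 : nat) (h alpha : int)
    (G : seq nat) (i j k : nat) (a a' a'' : nat -> nat) (K : fieldType)
    (HH : numerical_semigroup H)
    (HG : minimal_generators G H) (HGn : size G = n) (n_ge3 : (3 <= n)%N)
    (Ha0 : multiplicity_of H a0)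
    (h_gt0 : 0 < h) (alpha_neq0 : alpha != 0)
    (HPF : forall p : int, PF H p <->
       exists l : nat, (1 <= l <= n.-1)%N /\ p = h + l%:Z * alpha)
    (Hcop : coprimez a0%:Z alpha)
    (Hlab : labelling H alpha a0 G i j k a a' a'')
    (Hv : (vres a0 alpha (a i)%:Z
             + (if k == 0%N then 0%N else vres a0 (- alpha) (a'' 1%N)%:Z)
           < n.-1)%N) :
  (1 <= j)%N /\
  exists c c'' : nat -> nat,
    [/\ forall s, (s <= i)%N -> (0 < c s)%N,
        forall s, (s <= k)%N -> (0 < c'' s)%N
      & forall p : {mpoly K[(i + j + k).+1]},
          I_H a a' a'' p <->
          I2 (row_mx (row_mx (Mplus K i j k c) (Mzero K i j k))
                (Mminus K i j k c'')) p].
Proof.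
have nE : n.-1 = (i + j + k)%N by rewrite -HGn (size_generators HG Hlab).
have N_ge2 : (2 <= i + j + k)%N by rewrite -nE; lia.
rewrite nE in HPF Hv.
(* With [m] the residue of [h] and [e = c + 1], the element [h + l alpha + a0] of [PF_+] has residue
   [m + l] and coefficient [e]. *)
have [m_lt _] := vresP h (mult_gt0 Ha0) Hcop; have [c hc] := vres_decomp Ha0 Hcop h.
have hE : h = (vres a0 alpha h)%:Z * alpha + (c + 1 - 1) * a0%:Z by rewrite addrK.
split; first exact: (scroll_j_gt0 HH HG Ha0 Hcop N_ge2 HPF Hlab m_lt hE Hv).
exact: (toric_map_scroll HH HG Ha0 Hcop N_ge2 HPF Hlab m_lt hE Hv K).
Qed.
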